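(* Let $\Lambda_\Phi$ be a diagonal self-affine sponge in $[0,1]^d$ of generalized Lalley-Gatzouras type, generated by the diagonal self-affine IFS $\Phi=\{\phi_{\mathbf a}\}_{\mathbf a\in\mathcal D}$. Let $\tau$ be the permutation of $\{1,\dots,d\}$ for which $\phi'_{\mathbf a,\tau(1)}\ge\dots\ge\phi'_{\mathbf a,\tau(d)}$ for every $\mathbf a\in\mathcal D$ (and for which the neat projection condition holds). Let $\{\beta_j\}_{j=1}^d$ be the sequence associated with $\tau$, and $\beta(\tau)=\sum_{j=1}^d\beta_j$. Then $$\dim_B\Lambda_\Phi=\beta(\tau),$$ and the Bernoulli measure $\mu_\tau$ on $\Lambda_\Phi$ defined by the probability weight $$p_{\mathbf a}=\prod_{j=1}^d(\phi'_{\mathbf a,\tau(j)})^{\beta_j},\qquad \mathbf a\in\mathcal D,$$ is a cylinder box-counting measure.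
   Context: Diagonal self-affine sponge: $\mathcal D$ is a finite index set and $\Phi=\{\phi_{\mathbf a}\}_{\mathbf a\in\mathcal D}$ is a family of distinct contractions $\phi_{\mathbf a}(x_1,\dots,x_d)=(\phi_{\mathbf a,1}(x_1),\dots,\phi_{\mathbf a,d}(x_d))$ of $[0,1]^d$ into itself, where each $\phi_{\mathbf a,i}:[0,1]\to[0,1]$ is affine with constant derivative $\phi_{\mathbf a,i}'\in(0,1)$. $\Lambda_\Phi\subset[0,1]^d$ is the attractor, the unique nonempty compact set with $\Lambda_\Phi=\bigcup_{\mathbf a}\phi_{\mathbf a}(\Lambda_\Phi)$. Let $\tau$ be a permutation of $\{1,\dots,d\}$. For $1\le j\le d$ let $\Phi^\tau_j$ be the set of all maps $\mathbf f=(f_1,\dots,f_j)$ on $[0,1]^j$ of the form $(\phi_{\mathbf a,\tau(1)},\dots,\phi_{\mathbf a,\tau(j)})$, $\mathbf a\in\mathcal D$, each distinct map being counted only once. The sequence $\{\beta_j\}_{j=1}^d$ is defined inductively: $\beta_j$ is the unique real number such that $$\sum_{(f_1,\dots,f_j)\in\Phi^\tau_j}\ \prod_{k=1}^j(f_k')^{\beta_k}=1 .$$ $\Lambda_\Phi$ is of generalized Lalley-Gatzouras type if there is a permutation $\tau$ such that (weak coordinate ordering condition) $\phi'_{\mathbf a,\tau(1)}\ge\dots\ge\phi'_{\mathbf a,\tau(d)}$ for all $\mathbf a\in\mathcal D$, and (neat projection condition, with coordinates ordered by $\tau$) for every $j\in\{1,\dots,d\}$ the sets $\mathbf f((0,1)^j)$,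 $\mathbf f\in\Phi^\tau_j$, are pairwise disjoint. The Bernoulli measure with probability weight $(p_{\mathbf a})_{\mathbf a\in\mathcal D}$ is the push-forward to $\Lambda_\Phi$ of the product measure $(p_{\mathbf a})^{\otimes\mathbb N}$ on $\mathcal D^\infty$ under the coding map, i.e. the unique Borel probability measure with $\mu=\sum_{\mathbf a}p_{\mathbf a}\,\mu\circ\phi_{\mathbf a}^{-1}$. For a compact metric space $X$, $A\subset X$ and $\delta>0$, $\mathcal N_\delta(A)$ is the maximal number of pairwise disjoint (open) balls of $X$ of radius $\delta$ with centers in $A$; $\dim_BX=\lim_{\delta\to0}\frac{\log\mathcal N_\delta(X)}{-\log\delta}$ when the limit exists. A compact Vitalli-type covering of $X$ is a sequence $\mathcal F=\{\mathcal F_k\}_{k\ge1}$ of coverings of $X$ such that (i) every element of $\mathcal F_k$ is compact; (ii) there is an integer $\lambda$ such that for all $k$ each point of $X$ lies in at most $\lambda$ elements of $\mathcal F_k$; (iii) $\max\{\operatorname{diam}A:A\in\mathcal F_k\}\to0$. A finite Borel measure $\mu$ on $X$ (with $\beta=\dim_BX$ existing) is an $\mathcal F$-box-counting measure if there is $M>0$ such that for every $R\in\bigcup_k\mathcal F_k$ there is $\delta_0(R)>0$ with $M^{-1}\mu(R)\le\mathcal N_\delta(R)\delta^{\beta}\le M\mu(R)$ for all $0<\delta\le\delta_0(R)$. Cylinder box-counting measure: for the attractor $E=\Lambda_\Phi$, a $k$-th cylinder is a set $\phi_{i_1}\circ\dots\circ\phi_{i_k}(E)$ with $i_1\dots i_k\in\mathcal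 D^k$; let $\mathcal F_k$ be the collection of $k$-th cylinders. A finite Borel measure $\mu$ on $E$ is a cylinder box-counting measure if $\mathcal F=\{\mathcal F_k\}_{k\ge1}$ is a compact Vitalli-type covering of $E$ and $\mu$ is an $\mathcal F$-box-counting measure. *)

(* Defs.v *)
From HB Require Import structures.
From mathcomp Require Import all_boot all_order all_algebra all_fingroup.
From mathcomp Require Import all_classical all_reals all_analysis.

Set Implicit Arguments.
Unset Strict Implicit.
Unset Printing Implicit Defensive.

Import Order.TTheory GRing.Theory Num.Theory.
Import numFieldNormedType.Exports.

Local Open Scope classical_set_scope.
Local Open Scope ring_scope.

(* A metric space is given as a subset [X] of an ambient type with a distance
   function [dist]; balls of [X] are traces on [X] of ambient balls. *)
Section MetricNotions.
Context {R : realType} {T : Type}.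
Variable dist : T -> T -> R.

Definition open_ball (X : set T) (x : T) (delta : R) : set T :=
  [set y | X y /\ dist x y < delta].

(* Extended real valued, so that no convention is needed when the supremum is
   not attained; for [X] compact it is a natural number. *)
Definition packing_number (X A : set T) (delta : R) : \bar R :=
  ereal_sup [set (n%:R)%:E | n in [set n : nat |
    exists c : 'I_n -> T,
      (forall i, A (c i)) /\
      trivIset [set: 'I_n] (fun i => open_ball X (c i) delta)]].

Definition has_box_dim (X : set T) (beta : R) : Prop :=
  (lne (packing_number X X delta) * ((- ln delta)^-1)%:E)%E
    @[delta --> (0 : R)^'+] --> beta%:E.

Definition diam (A : set T) : \bar R :=
  ereal_sup [set (dist xy.1 xy.2)%:E | xy in A `*` A].

End MetricNotions.

Notation borel T := (g_sigma_algebraType (@open T)).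

Section BoxCounting.
Context {R : realType} {T : ptopologicalType}.
Variable dist : T -> T -> R.

(* Coverings are indexed from 1: the value [F 0] is never used. *)
Definition compact_vitali_covering (X : set T) (F : nat -> set (set T)) : Prop :=
  [/\ forall k, (0 < k)%N -> \bigcup_(A in F k) A = X,
      forall k A, (0 < k)%N -> F k A -> compact A,
      exists lambda : nat, forall k x, (0 < k)%N -> X x ->
        ([set A | F k A /\ A x] #<= `I_lambda)%card
    & ereal_sup [set diam dist A | A in F k] @[k --> \oo] --> (0 : \bar R)].

(* Finite Borel measures on [X] are the finite Borel measures on the ambient
   space giving mass 0 to the complement of [X]. *)
Definition box_counting_measure (X : set T) (F : nat -> set (set T))
    (mu : {finite_measure set (borel T) -> \bar R}) : Prop :=
  mu (~` X) = 0%E /\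
  exists beta : R, has_box_dim dist X beta /\
  exists M : R, 0 < M /\
    forall k A, (0 < k)%N -> F k A ->
    exists delta0 : R, 0 < delta0 /\
    forall delta : R, 0 < delta <= delta0 ->
      ((M^-1)%:E * mu A <= packing_number dist X A delta * (delta `^ beta)%:E /\
       packing_number dist X A delta * (delta `^ beta)%:E <= M%:E * mu A)%E.

End BoxCounting.

Section Sponge.
Context {R : realType}.

(* The pair [(r, t)] stands for the affine map x |-> r * x + t of the line;
   distinct pairs are distinct maps. *)
Definition slope (f : R * R) : R := f.1.
Definition aff (f : R * R) (x : R) : R := f.1 * x + f.2.

Definition diag_map n (f : {ffun 'I_n -> R * R}) (x : 'rV[R]_n) : 'rV[R]_n :=
  \row_i aff (f i) (x ord0 i).

Definition unit_cube n : set 'rV[R]_n :=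
  [set x | forall i, 0 <= x ord0 i <= 1].
Definition open_unit_cube n : set 'rV[R]_n :=
  [set x | forall i, 0 < x ord0 i < 1].

Definition euclid n (x y : 'rV[R]_n) : R :=
  Num.sqrt (\sum_(i < n) (x ord0 i - y ord0 i) ^+ 2).

Section IFS.
Context {d : nat} {D : finType}.
Variable Phi : D -> {ffun 'I_d -> R * R}.

Definition diagonal_ifs : Prop :=
  [/\ forall a i, 0 < slope (Phi a i) < 1,
      forall a i x, 0 <= x <= 1 -> 0 <= aff (Phi a i) x <= 1
    & forall a b, {in @unit_cube d, diag_map (Phi a) =1 diag_map (Phi b)} ->
        a = b].

Definition attractor (E : set 'rV[R]_d) : Prop :=
  [/\ E !=set0, compact E, E `<=` @unit_cube d
    & E = \bigcup_(a in [set: D]) (diag_map (Phi a) @` E)].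

Definition word_map (w : seq D) : 'rV[R]_d -> 'rV[R]_d :=
  foldr (fun a g => diag_map (Phi a) \o g) id w.

Definition cylinders (E : set 'rV[R]_d) (k : nat) : set (set 'rV[R]_d) :=
  [set word_map w @` E | w in [set: k.-tuple D]].

(* Ordinals start at 0: the index [j : 'I_d] refers to the (j+1)-st coordinate
   and to the projection on the first j+1 coordinates. *)
Section Order.
Variable tau : 'S_d.

Definition proj_map (j : 'I_d) (a : D) : {ffun 'I_j.+1 -> R * R} :=
  [ffun k => Phi a (tau (widen_ord (ltn_ord j) k))].

Definition proj_ifs (j : 'I_d) : seq {ffun 'I_j.+1 -> R * R} :=
  undup [seq proj_map j a | a : D].

Definition coordinate_ordering : Prop :=
  forall a (i j : 'I_d), (i <= j)%N ->
    slope (Phi a (tau j)) <= slope (Phi a (tau i)).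

Definition neat_projection : Prop :=
  forall j : 'I_d,
    trivIset [set` proj_ifs j] (fun f => diag_map f @` @open_unit_cube j.+1).

(* The equation for [j] involves [beta] only at indices at most [j], and
   determines [beta j] from the earlier values. *)
Definition beta_sequence (beta : 'I_d -> R) : Prop :=
  forall j : 'I_d,
    \sum_(f <- proj_ifs j)
      \prod_(k < j.+1) slope (f k) `^ beta (widen_ord (ltn_ord j) k) = 1.

Definition tau_weight (beta : 'I_d -> R) (a : D) : R :=
  \prod_(j < d) slope (Phi a (tau j)) `^ beta j.

End Order.

Definition coding (omega : nat -> D) : 'rV[R]_d :=
  lim (word_map (mkseq omega n) 0 @[n --> \oo]).

End IFS.
End Sponge.

(* The space of infinite sequences over [D] with its product sigma-algebra;
   the letter [a0] only serves to make the type pointed. *)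
Definition code_cylinder (D : finType) (w : seq D) : set (nat -> D) :=
  [set omega | mkseq omega (size w) = w].
Definition code_space (D : finType) (a0 : D) : Type := nat -> D.
HB.instance Definition _ (D : finType) (a0 : D) :=
  Choice.copy (code_space a0) (nat -> D).
HB.instance Definition _ (D : finType) (a0 : D) :=
  isPointed.Build (code_space a0) (fun=> a0).
Notation code_measurable a0 :=
  (g_sigma_algebraType
     (range (@code_cylinder _) : set (set (code_space a0)))).

Section Bernoulli.
Context {R : realType} {d : nat} {D : finType}.
Variable Phi : D -> {ffun 'I_d -> R * R}.

Definition product_measure (p : D -> R) (a0 : D)
    (nu : probability (code_measurable a0) R) : Prop :=
  forall w : seq D, nu (code_cylinder w) = (\prod_(a <- w) p a)%:E.

Definition bernoulli_measure (p : D -> R)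
    (mu : probability (borel 'rV[R]_d) R) : Prop :=
  exists (a0 : D) (nu : probability (code_measurable a0) R),
    product_measure p nu /\
    forall A, measurable A ->
      mu A = pushforward nu (coding Phi : code_measurable a0 -> borel 'rV[R]_d) A.

Definition cylinder_box_counting_measure (E : set 'rV[R]_d)
    (mu : {finite_measure set (borel 'rV[R]_d) -> \bar R}) : Prop :=
  compact_vitali_covering (@euclid R d) E (cylinders Phi E) /\
  box_counting_measure (@euclid R d) E (cylinders Phi E) mu.

End Bernoulli.

(* Main.v *)
From HB Require Import structures.
Require Import Defs.
From mathcomp Require Import all_boot all_order all_algebra all_fingroup.
From mathcomp Require Import all_classical all_reals all_analysis.
From mathcomp Require Import ring lra zify.

Set Implicit Arguments.
Unset Strict Implicit.
Unset Printing Implicit Defensive.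

Import Order.TTheory GRing.Theory Num.Theory.
Import numFieldNormedType.Exports.

Local Open Scope classical_set_scope.
Local Open Scope ring_scope.

(* Fix [delta] and compose the maps of a word coordinatewise, stopping each
   coordinate when its side drops below [delta]. By the coordinate ordering the
   coordinates still running always form an initial segment 1..j (in the order
   of tau), so extending a word only requires a map of Phi_j^tau, and giving a
   box with sides s_1, ..., s_d the weight prod_j s_j^{beta_j}, the equations
   defining beta say that this weight is preserved in total. All final boxes
   have sides comparable to delta, hence weight comparable to delta^beta: inside
   the cylinder of w there are about p_w delta^{-beta} of them. Each contains a
   point of the cylinder, their interiors are disjoint by neat projection, and
   they cover the cylinder, so N_delta is comparable to p_w delta^{-beta}.
   It remains to see that the cylinder of w has mass exactly p_w: if a code not
   starting with w is sent into it, the image lies on a face common to two boxes,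
   and then some letter never occurs in the tail of the code, a null event. *)

(** * Boxes of words *)

Lemma aff_comp {R : realType} (f g : R * R) (x : R) :
  aff f (aff g x) = aff (f.1 * g.1, f.1 * g.2 + f.2) x.
Proof. by rewrite /aff /=; ring. Qed.

Section Boxes.
Context {R : realType} {d : nat} {D : finType}.
Variable Phi : D -> {ffun 'I_d -> R * R}.

Lemma word_map_rcons (w : seq D) a x :
  word_map Phi (rcons w a) x = word_map Phi w (diag_map (Phi a) x).
Proof. by rewrite /word_map foldr_rcons; elim: w x => //= b w IH x; rewrite IH. Qed.

Lemma word_map_cat (v w : seq D) x :
  word_map Phi (v ++ w) x = word_map Phi v (word_map Phi w x).
Proof. by elim: v => //= b v ->. Qed.

(* For [delta = 0] this is the [i]-th coordinate of [word_map]; for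
   [delta > 0] the composition is frozen as soon as its slope is at most
   [delta], so that long words get boxes with sides of length about [delta]. *)
Definition stopped (delta : R) (i : 'I_d) (w : seq D) : R * R :=
  foldl (fun s a => if delta < s.1
    then (s.1 * (Phi a i).1, s.1 * (Phi a i).2 + s.2) else s) (1, 0) w.

Lemma stopped_rcons delta i w a : stopped delta i (rcons w a) =
  if delta < (stopped delta i w).1
  then ((stopped delta i w).1 * (Phi a i).1,
        (stopped delta i w).1 * (Phi a i).2 + (stopped delta i w).2)
  else stopped delta i w.
Proof. by rewrite /stopped foldl_rcons. Qed.

(** A pair [(s, t)] is identified with the interval [[t, s + t]], the image of [[0, 1]] under its
    affine map. *)
Definition in_box delta (v : seq D) (x : 'rV[R]_d) := forall i,
  (stopped delta i v).2 <= x ord0 i <=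
  (stopped delta i v).1 + (stopped delta i v).2.

Hypothesis ifsPhi : diagonal_ifs Phi.

Lemma ratio_gt0 a i : 0 < (Phi a i).1.
Proof. by case: ifsPhi => /(_ a i)/andP[]. Qed.

Lemma ratio_lt1 a i : (Phi a i).1 < 1.
Proof. by case: ifsPhi => /(_ a i)/andP[]. Qed.

Lemma shift_ge0 a i : 0 <= (Phi a i).2.
Proof.
case: ifsPhi => _ /(_ a i 0) + _; rewrite lexx ler01 /aff mulr0 add0r => /(_ isT).
by case/andP.
Qed.

Lemma shift_le1 a i : (Phi a i).1 + (Phi a i).2 <= 1.
Proof.
case: ifsPhi => _ /(_ a i 1) + _; rewrite lexx ler01 /aff mulr1 => /(_ isT).
by case/andP.
Qed.

Lemma Phi_inj : injective Phi.
Proof. by case: ifsPhi => _ _ inj a b ab; apply: inj => x _; rewrite ab. Qed.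

(** The number [s (1 - s)] lies below both [s] and [1 - s], so the product of these numbers over all
    letters and coordinates bounds every slope away from 0 and from 1; the factor 1/2 keeps [r]
    below 1 even for an empty product. *)
Lemma ratio_bound : exists2 r : R, 0 < r < 1 &
  forall a i, r <= (Phi a i).1 <= 1 - r.
Proof.
pose F (p : D * 'I_d) := (Phi p.1 p.2).1 * (1 - (Phi p.1 p.2).1).
pose r := 2^-1 * \prod_p F p.
have F01 (p : D * 'I_d) : 0 < F p < 1.
  by rewrite /F; have := ratio_gt0 p.1 p.2; have := ratio_lt1 p.1 p.2; nra.
have P01 (P : pred (D * 'I_d)) : 0 < \prod_(p | P p) F p <= 1.
  apply/andP; split; first by apply: prodr_gt0 => p _; case/andP: (F01 p).
  by apply: prodr_ile1 => p _; case/andP: (F01 p) => /ltW -> /ltW ->.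
exists r.
  by have := P01 xpredT; rewrite /r; lra.
move=> a i; have /andP[X0 X1] := P01 (fun p => p != (a, i)).
rewrite /r (bigD1 (a, i)) //= /F /=.
move: X0 X1; move: (\prod_(p | p != (a, i)) F p) => X X0 X1.
have := ratio_gt0 a i; have := ratio_lt1 a i; set s := (Phi a i).1 => s1 s0.
have sX : 0 < s * (1 - s) * X <= s * (1 - s).
  have s1' : 0 < 1 - s by rewrite subr_gt0.
  by rewrite !mulr_gt0 //= ler_piMr // ltW // mulr_gt0.
move: sX; set y := s * (1 - s) * X => /andP[y0 y1].
have : s * (1 - s) <= s /\ s * (1 - s) <= 1 - s by split; nra.
by move=> [h1 h2]; apply/andP; split; lra.
Qed.

Lemma stopped_gt0 delta i w : 0 < (stopped delta i w).1.
Proof.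
elim/last_ind: w => [|w a IH]; first by rewrite /stopped /= ltr01.
by rewrite stopped_rcons; case: ifP => //= _; rewrite mulr_gt0// ratio_gt0.
Qed.

Lemma stopped_nest1 delta i w a :
  (stopped delta i w).2 <= (stopped delta i (rcons w a)).2 /\
  (stopped delta i (rcons w a)).1 + (stopped delta i (rcons w a)).2 <=
  (stopped delta i w).1 + (stopped delta i w).2.
Proof.
rewrite stopped_rcons; case: ifP => //= _.
have := stopped_gt0 delta i w; have := shift_ge0 a i; have := shift_le1 a i.
by case: (stopped delta i w) => s t /= h1 h2 s0; split; nra.
Qed.

Lemma stopped_nest delta i w v :
  (stopped delta i w).2 <= (stopped delta i (w ++ v)).2 /\
  (stopped delta i (w ++ v)).1 + (stopped delta i (w ++ v)).2 <=
  (stopped delta i w).1 + (stopped delta i w).2.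
Proof.
elim/last_ind: v => [|v a [IH1 IH2]]; first by rewrite cats0.
rewrite -rcons_cat; have [h1 h2] := stopped_nest1 delta i (w ++ v) a.
by split; [exact: le_trans h1|exact: le_trans IH2].
Qed.

Lemma stopped_dec delta i w a :
  (stopped delta i (rcons w a)).1 <= (stopped delta i w).1.
Proof.
rewrite stopped_rcons; case: ifP => //= _.
by rewrite ler_piMr // ltW // ?stopped_gt0 ?ratio_lt1.
Qed.

Lemma stopped0_rcons i w a : stopped 0 i (rcons w a) =
  ((stopped 0 i w).1 * (Phi a i).1,
   (stopped 0 i w).1 * (Phi a i).2 + (stopped 0 i w).2).
Proof. by rewrite stopped_rcons stopped_gt0. Qed.

Lemma stopped_cases delta i w : 0 <= delta ->
  stopped delta i w = stopped 0 i w \/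
  [/\ (stopped delta i w).1 <= delta, (stopped 0 i w).1 <= delta,
   (stopped delta i w).2 <= (stopped 0 i w).2 &
   (stopped 0 i w).1 + (stopped 0 i w).2 <=
   (stopped delta i w).1 + (stopped delta i w).2].
Proof.
move=> d0; elim/last_ind: w => [|w a [IH|[IH1 IH2 IH3 IH4]]]; first by left.
- have [h|h] := ltP delta (stopped delta i w).1.
    by left; rewrite stopped_rcons h IH stopped0_rcons.
  right; rewrite [stopped delta i _]stopped_rcons ltNge h /= IH.
  have [h1 h2] := stopped_nest1 0 i w a; split => //; first by rewrite -IH.
  by rewrite (le_trans (stopped_dec 0 i w a)) // -IH.
- right; rewrite [stopped delta i _]stopped_rcons ltNge IH1 /=.
  have [h1 h2] := stopped_nest1 0 i w a; split => //.
  + by rewrite (le_trans (stopped_dec 0 i w a)).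
  + exact: le_trans h1.
  + exact: le_trans IH4.
Qed.

Lemma stopped_active delta i w : 0 <= delta ->
  (delta < (stopped delta i w).1) = (delta < (stopped 0 i w).1).
Proof.
by move=> /(stopped_cases i w)[->//|[h1 h2 _ _]]; rewrite !ltNge h1 h2.
Qed.

Lemma stopped_eq0 delta i w : 0 <= delta -> delta < (stopped 0 i w).1 ->
  stopped delta i w = stopped 0 i w.
Proof.
by move=> /(stopped_cases i w)[//|[_ h _ _]]; rewrite ltNge h.
Qed.

Lemma word_mapE w x i : word_map Phi w x ord0 i = aff (stopped 0 i w) (x ord0 i).
Proof.
elim/last_ind: w x => [|w a IH] x; first by rewrite /aff /= mul1r addr0.
by rewrite word_map_rcons IH mxE aff_comp stopped0_rcons.
Qed.

Lemma stopped0_prod i w : (stopped 0 i w).1 = \prod_(a <- w) (Phi a i).1.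
Proof.
elim/last_ind: w => [|w a IH]; first by rewrite big_nil.
by rewrite stopped0_rcons /= IH -cats1 big_cat big_seq1.
Qed.

Lemma in_box_word delta w x : 0 <= delta -> unit_cube x ->
  in_box delta w (word_map Phi w x).
Proof.
move=> d0 x01 i; rewrite word_mapE /aff.
have := x01 i; have := stopped_gt0 0 i w.
case: (stopped_cases i w d0) => [->|[_ _]]; first by nra.
by nra.
Qed.

(** A slope is multiplied only while it exceeds [delta], and then by at least [r], so the last
    multiplication leaves it above [r * delta]. *)
Lemma stopped_gt_ratio (r delta : R) i w : 0 < r < 1 -> 0 < delta < 1 ->
  (forall a i, r <= (Phi a i).1) -> r * delta < (stopped delta i w).1.
Proof.
move=> r01 d01 hr; elim/last_ind: w => [|w a IH]; first by rewrite /=; nra.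
rewrite stopped_rcons; case: ifP => //= h; have := hr a i; nra.
Qed.

Lemma stopped0_geo (r : R) i w : 0 < r < 1 ->
  (forall a i, (Phi a i).1 <= 1 - r) ->
  (stopped 0 i w).1 <= (1 - r) ^+ size w.
Proof.
move=> r01 hr; rewrite stopped0_prod; elim: w => [|a w IH]; first by rewrite big_nil expr0.
rewrite big_cons exprS ler_pM ?hr ?(ltW (ratio_gt0 _ _)) //.
by apply: prodr_ge0 => b _; rewrite ltW ?ratio_gt0.
Qed.

Lemma stopped_small (r delta : R) : 0 < r < 1 -> 0 < delta ->
  (forall a i, (Phi a i).1 <= 1 - r) ->
  exists n, forall i w, (n <= size w)%N -> (stopped delta i w).1 <= delta.
Proof.
move=> r01 d0 hr.
have : (fun n => (1 - r) ^+ n) @ \oo --> (0 : R).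
  by apply: cvg_expr; rewrite ger0_norm; lra.
move/cvgr0Pnorm_lt => /(_ _ d0)[n _ hn]; exists n => i w nw.
rewrite leNgt stopped_active ?ltW //; apply/negP => h.
have := stopped0_geo i w r01 hr; have := hn _ nw => /=.
by rewrite ger0_norm ?exprn_ge0; lra.
Qed.

End Boxes.

(** * Boxes of side delta *)

(** Common endpoints are allowed, since neat projection only concerns open cubes. *)
Definition disj_itv {R : realType} (f g : R * R) :=
  f.1 + f.2 <= g.2 \/ g.1 + g.2 <= f.2.

Section Leaves.
Context {R : realType} {d : nat} {D : finType}.
Variable Phi : D -> {ffun 'I_d -> R * R}.

Definition agree (A : pred 'I_d) (a b : D) : bool :=
  [forall i, A i ==> (Phi a i == Phi b i)].

Lemma agreeP (A : pred 'I_d) a b :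
  reflect (forall i, A i -> Phi a i = Phi b i) (agree A a b).
Proof.
apply: (iffP forallP) => [h i Ai|h i]; first by move: (h i); rewrite Ai => /eqP.
by apply/implyP => Ai; rewrite h.
Qed.

(** The choice made by [pick] depends only on the class of letters agreeing with [a], so agreeing
    letters get the same representative. The default is never reached, as [a] agrees with itself. *)
Definition rep (A : pred 'I_d) (a : D) : D := odflt a [pick b | agree A a b].

Lemma rep_agree A a : agree A a (rep A a).
Proof. by rewrite /rep; case: pickP => // _; apply/agreeP. Qed.

Lemma agree_rep A a b : agree A a b -> rep A a = rep A b.
Proof.
move=> /agreeP ab; rewrite /rep.
have -> : [pick c | agree A a c] = [pick c | agree A b c].
  apply: eq_pick => c; apply/agreeP/agreeP => h i Ai; last by rewrite ab // h.
  by rewrite -ab // h.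
by case: pickP => //= /(_ b); rewrite (introT (agreeP _ _ _)).
Qed.

(** For [A] a nonempty initial segment in the order of [tau], these letters enumerate the maps of
    the corresponding [proj_ifs] without repetition. *)
Definition reps (A : pred 'I_d) : seq D := [seq a <- enum D | rep A a == a].

Lemma mem_reps A a : (a \in reps A) = (rep A a == a).
Proof. by rewrite mem_filter mem_enum andbT. Qed.

Lemma rep_reps A a : rep A a \in reps A.
Proof. by rewrite mem_reps -(agree_rep (rep_agree A a)). Qed.

Lemma reps_uniq A : uniq (reps A).
Proof. by rewrite filter_uniq // enum_uniq. Qed.

Lemma reps_inj A : {in reps A &, forall a b, agree A a b -> a = b}.
Proof.
move=> a b; rewrite !mem_reps => /eqP ha /eqP hb /agree_rep.
by rewrite ha hb.
Qed.

Definition active (delta : R) (v : seq D) : pred 'I_d :=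
  fun i => delta < (stopped Phi delta i v).1.

(** All leaves have the same length although their coordinates freeze at different times: once every
    coordinate is frozen all letters agree, a single representative is left, and surplus letters
    create no new box. *)
Fixpoint leaves (delta : R) (n : nat) (u : seq D) : seq (seq D) :=
  if n is n'.+1
  then [seq rcons v a | v <- leaves delta n' u, a <- reps (active delta v)]
  else [:: u].

Lemma leaves_rconsP delta n u v : reflect
  (exists v' a, [/\ v' \in leaves delta n u, a \in reps (active delta v') &
     v = rcons v' a])
  (v \in leaves delta n.+1 u).
Proof.
apply: (iffP allpairsPdep) => -[v' [a [h1 h2 h3]]].
  by exists v', a.
by exists v', a.
Qed.

Lemma leaves_cat delta n u v : v \in leaves delta n u ->
  exists2 w, v = u ++ w & size w = n.
Proof.
elim: n v => [|n IH] v; first by rewrite inE => /eqP ->; exists [::]; rewrite ?cats0.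
case/leaves_rconsP => v' [a [/IH[w -> <-] _ ->]].
by exists (rcons w a); rewrite ?rcons_cat ?size_rcons.
Qed.

Lemma leaves_uniq delta n u : uniq (leaves delta n u).
Proof.
elim: n => //= n IH; apply: allpairs_uniq_dep => // [v _|].
  exact: reps_uniq.
by move=> [v a] [w b] _ _ /= /rcons_inj[-> ->].
Qed.

Hypothesis ifsPhi : diagonal_ifs Phi.

(* The letters followed by a leaf need not be those of the code of [x]: they
   only have to agree in the active coordinates. *)
Lemma leaves_cover (E : set 'rV[R]_d) delta n u x : attractor Phi E ->
  0 <= delta -> (word_map Phi u @` E) x ->
  exists2 v, v \in leaves delta n u & in_box Phi delta v x.
Proof.
case=> _ _ E01 EE d0 ux.
suff [v vl [w vw [e Ee <-]]] : exists2 v, v \in leaves delta n u & exists2 w,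
    (forall i, stopped Phi delta i v = stopped Phi delta i w) &
    (word_map Phi w @` E) x.
  by exists v => // i; rewrite vw; apply: in_box_word (E01 _ Ee) i.
elim: n => [|n [v vl [w vw [e]]]].
  by exists u; [rewrite inE | exists u].
rewrite {1}EE => -[a _ [e' Ee' <-]] wx.
exists (rcons v (rep (active delta v) a)).
  by apply/leaves_rconsP; exists v, (rep (active delta v) a); rewrite rep_reps.
exists (rcons w a); last by exists e' => //; rewrite word_map_rcons.
move=> i; rewrite !stopped_rcons -!vw; case: ifP => // h.
by rewrite (elimT (agreeP _ _ _) (rep_agree (active delta v) a) i h).
Qed.

(** * Separation of boxes by neat projection *)

Variable tau : 'S_d.
Hypothesis order : coordinate_ordering Phi tau.
Hypothesis neat : neat_projection Phi tau.

Definition tau_closed (A : pred 'I_d) :=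
  forall j k : 'I_d, (j <= k)%N -> A (tau k) -> A (tau j).

(** The ordering is given letter by letter. It passes to words because their slopes are products,
    and to stopped words because activity can be read off the unstopped slopes. *)
Lemma active_tau_closed delta v : 0 <= delta -> tau_closed (active delta v).
Proof.
move=> d0 j k jk; rewrite /active !stopped_active // => /lt_le_trans; apply.
rewrite !stopped0_prod //; elim: v => [|a v IH]; first by rewrite !big_nil.
rewrite !big_cons ler_pM //; first exact/ltW/ratio_gt0.
  by apply: prodr_ge0 => b _; exact/ltW/ratio_gt0.
exact: order.
Qed.

Lemma tau_closed_true : tau_closed xpredT.
Proof. by []. Qed.

Lemma proj_map_agree (j : 'I_d) a b : proj_map Phi tau j a = proj_map Phi tau j b <->
  forall k : 'I_d, (k <= j)%N -> Phi a (tau k) = Phi b (tau k).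
Proof.
split=> [/ffunP h k kj|h]; last first.
  by apply/ffunP => k; rewrite !ffunE; apply: h; rewrite /= -ltnS.
have kj1 : (k < j.+1)%N by [].
move: (h (Ordinal kj1)); rewrite !ffunE.
by rewrite (_ : widen_ord _ _ = k) //; apply: val_inj.
Qed.

Lemma mem_proj_ifs j f :
  (f \in proj_ifs Phi tau j) = (f \in [seq proj_map Phi tau j a | a : D]).
Proof. by rewrite mem_undup. Qed.

(** At the first index [j] where the two letters differ, overlapping intervals would yield interior
    points of the cube with the same image under both projected maps; neat projection would then
    make these maps equal. *)
Lemma separate_maps (A : pred 'I_d) a b : tau_closed A -> ~~ agree A a b ->
  exists2 i, A i & disj_itv (Phi a i) (Phi b i).
Proof.
move=> Acl; rewrite negb_forall => /existsP[i]; rewrite negb_imply => /andP[Ai abi].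
have : exists j, Phi a (tau j) != Phi b (tau j).
  by exists (tau^-1%g i); rewrite permKV.
move=> [j0 hj0].
have [j abj jmin] := @arg_minnP _ j0
  (fun j => Phi a (tau j) != Phi b (tau j)) (fun j : 'I_d => val j) hj0.
exists (tau j).
  (* The letters differ at the coordinate [i] of [A], which comes no earlier than [tau j], so
     closedness puts [tau j] in [A]. *)
  apply: (Acl _ (tau^-1%g i)); rewrite ?permKV //.
  by apply: jmin; rewrite permKV.
have abk (k : 'I_d) : (k < j)%N -> Phi a (tau k) = Phi b (tau k).
  move=> kj; apply/eqP/negPn/negP => /jmin; by rewrite leqNgt kj.
have [//|h1] := leP ((Phi a (tau j)).1 + (Phi a (tau j)).2) (Phi b (tau j)).2; first by left.
have [//|h2] := leP ((Phi b (tau j)).1 + (Phi b (tau j)).2) (Phi a (tau j)).2; first by right.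
exfalso; move/negP: abj; apply; apply/eqP.
have ra := ratio_gt0 ifsPhi a (tau j); have rb := ratio_gt0 ifsPhi b (tau j).
pose l := Num.max (Phi a (tau j)).2 (Phi b (tau j)).2.
pose h := Num.min ((Phi a (tau j)).1 + (Phi a (tau j)).2)
  ((Phi b (tau j)).1 + (Phi b (tau j)).2).
have lh : l < h by rewrite /l /h lt_min !gt_max h1 h2 !ltrDr ra rb.
pose z := (l + h) / 2.
have lz : l < z by rewrite /z; lra.
have zh : z < h by rewrite /z; lra.
move: lz zh; rewrite lt_min gt_max => /andP[az bz] /andP[za zb].
(* Earlier coordinates, where both maps coincide, take the interior value 1/2; the last one takes
   the preimage of the common value [z]. *)
pose pt c : 'rV[R]_j.+1 := \row_(k < j.+1) if (k < j)%N then 2^-1 else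
  (z - (Phi c (tau j)).2) / (Phi c (tau j)).1.
have pt01 c : 0 < (Phi c (tau j)).1 -> (Phi c (tau j)).2 < z ->
    z < (Phi c (tau j)).1 + (Phi c (tau j)).2 -> open_unit_cube (pt c).
  move=> rc cz zc k; rewrite mxE; case: ifP => _.
    by rewrite invr_gt0 ltr0n invf_lt1 ?ltr1n.
  by rewrite divr_gt0 ?subr_gt0 //= ltr_pdivrMr // mul1r ltrBlDr.
have wj (k : 'I_j.+1) : ~~ (k < j)%N -> widen_ord (ltn_ord j) k = j.
  by rewrite -leqNgt => jk; apply: val_inj => /=; apply/eqP; rewrite eqn_leq jk -ltnS ltn_ord.
have ptE : diag_map (proj_map Phi tau j a) (pt a) =
           diag_map (proj_map Phi tau j b) (pt b).
  apply/rowP => k; rewrite !mxE !ffunE; case: ifPn => kj.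
    by rewrite abk.
  by rewrite wj // /aff ![_ * (_ / _)]mulrC !divfK ?gt_eqF // !subrK.
have : proj_map Phi tau j a = proj_map Phi tau j b.
  apply: (neat (j := j)) => //=.
  - by rewrite mem_proj_ifs map_f // mem_enum.
  - by rewrite mem_proj_ifs map_f // mem_enum.
  - exists (diag_map (proj_map Phi tau j a) (pt a)); split.
      by exists (pt a) => //; exact: pt01.
    by exists (pt b); [exact: pt01|rewrite ptE].
by move/proj_map_agree; apply.
Qed.

Lemma disj_nest (f g f' g' : R * R) : disj_itv f g ->
  f.2 <= f'.2 /\ f'.1 + f'.2 <= f.1 + f.2 ->
  g.2 <= g'.2 /\ g'.1 + g'.2 <= g.1 + g.2 -> disj_itv f' g'.
Proof. by move=> [h|h] [? ?] [? ?]; [left|right]; lra. Qed.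

Lemma disj_rcons delta w a b i : active delta w i ->
  disj_itv (Phi a i) (Phi b i) ->
  disj_itv (stopped Phi delta i (rcons w a)) (stopped Phi delta i (rcons w b)).
Proof.
rewrite /active !stopped_rcons => -> /=.
have := stopped_gt0 ifsPhi delta i w.
by case: (stopped Phi delta i w) => s t /= s0 [h|h]; [left|right] => /=; nra.
Qed.

(** Where two leaves branch, their letters represent different maps in the active coordinates, so
    some active coordinate separates them; later letters only shrink the boxes. *)
Lemma separate_leaves delta n u v w : 0 <= delta ->
  v \in leaves delta n u -> w \in leaves delta n u -> v != w ->
  exists i, disj_itv (stopped Phi delta i v) (stopped Phi delta i w).
Proof.
move=> d0; elim: n v w => [|n IH] v w.
  by rewrite !inE => /eqP-> /eqP->; rewrite eqxx.
case/leaves_rconsP => v' [a [v'l av' ->]].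
case/leaves_rconsP => w' [b [w'l bw' ->]] ne.
have [vw|vw] := eqVneq v' w'.
  subst w'; have nab : ~~ agree (active delta v') a b.
    by apply: contraNN ne => /reps_inj-> //.
  have [i Ai hi] := separate_maps (active_tau_closed d0) nab.
  by exists i; exact: disj_rcons.
have [i hi] := IH _ _ v'l w'l vw.
by exists i; apply: disj_nest hi _ _; exact: stopped_nest1.
Qed.

(** The first conjunct is kept for the null set argument: it provides letters whose intervals in
    coordinate [i] avoid a prescribed end of [[0, 1]]. *)
Lemma separate_words v w : size v = size w -> v != w ->
  exists i, (exists a b, disj_itv (Phi a i) (Phi b i)) /\
  disj_itv (stopped Phi 0 i v) (stopped Phi 0 i w).
Proof.
elim/last_ind: v w => [|v a IH] w; first by case: w.
case/lastP: w => [|w b]; rewrite !size_rcons // => -[svw] ne.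
have [vw|vw] := eqVneq v w.
  subst w; have nab : ~~ agree xpredT a b.
    apply: contraNN ne => /agreeP ab; apply/eqP; congr rcons.
    by apply: (Phi_inj ifsPhi); apply/ffunP => i; exact: ab.
  have [i _ hi] := separate_maps tau_closed_true nab.
  exists i; split; first by exists a, b.
  by apply: disj_rcons => //; exact: stopped_gt0.
have [i [h hi]] := IH _ svw vw.
by exists i; split => //; apply: disj_nest hi _ _; exact: stopped_nest1.
Qed.

(** * Conservation of weight along the leaves *)

Variable beta : 'I_d -> R.
Hypothesis betaP : beta_sequence Phi tau beta.

Lemma sum_reps (A : pred 'I_d) (a0 : D) : tau_closed A ->
  \sum_(a <- reps A) \prod_(j < d | A (tau j)) (Phi a (tau j)).1 `^ beta j = 1.
Proof.
move=> Acl; have [[j0 Aj0]|A0] := pselect (exists j, A (tau j)); last first.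
  (* With no coordinate in [A] all letters agree: there is one representative, and its product is
     empty. *)
  have An i : A i = false.
    by apply/negP => Ai; apply: A0; exists (tau^-1%g i); rewrite permKV.
  rewrite (@perm_big _ _ _ _ _ [:: rep A a0]) /=; last first.
    apply: uniq_perm => //; first exact: reps_uniq.
    move=> a; rewrite inE; apply/idP/eqP => [ha|->]; last exact: rep_reps.
    by apply: reps_inj ha (rep_reps _ _) _; apply/agreeP => i; rewrite An.
  by rewrite big_seq1 big1 // => j; rewrite An.
(* For the last index [j] in [A], the set [A] is exactly the segment up to [j], and the claim
   becomes the equation defining [beta j]. *)
have [j Aj jmax] := @arg_maxnP _ j0 (fun j => A (tau j)) (fun j : 'I_d => val j) Aj0.
have AE k : A (tau k) = (k < j.+1)%N.
  by rewrite ltnS; apply/idP/idP => [/jmax //|/Acl]; apply.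
have agE a b : agree A a b <-> proj_map Phi tau j a = proj_map Phi tau j b.
  rewrite proj_map_agree; split.
    by move=> /agreeP h k kj; apply: h; rewrite AE ltnS.
  move=> h; apply/agreeP => i; rewrite -[i](permKV tau) AE ltnS; exact: h.
apply: etrans (betaP j).
rewrite [RHS](@perm_big _ _ _ _ _ [seq proj_map Phi tau j a | a <- reps A]) /=.
  rewrite big_map; apply: eq_bigr => a _.
  rewrite (eq_bigl (fun k : 'I_d => k < j.+1)%N) //.
  rewrite (big_ord_narrow (ltn_ord j)).
  by apply: eq_bigr => k _; rewrite ffunE.
apply: uniq_perm; first exact: undup_uniq.
  rewrite map_inj_in_uniq ?reps_uniq // => a b ha hb /agE; exact: reps_inj.
move=> f; rewrite mem_proj_ifs; apply/mapP/mapP => -[a ha ->].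
  by exists (rep A a); [exact: rep_reps|apply/agE/rep_agree].
by exists a; rewrite ?mem_enum.
Qed.

Definition box_weight delta (v : seq D) : R :=
  \prod_(j < d) (stopped Phi delta (tau j) v).1 `^ beta j.

Lemma box_weight_rcons delta v a : box_weight delta (rcons v a) =
  box_weight delta v *
  \prod_(j < d | active delta v (tau j)) (Phi a (tau j)).1 `^ beta j.
Proof.
rewrite /box_weight [X in _ * X]big_mkcond -big_split /=; apply: eq_bigr => j _.
rewrite stopped_rcons /active; case: ifP => _; last by rewrite mulr1.
by rewrite powRM // ltW // ?stopped_gt0 ?ratio_gt0.
Qed.

(** Each extension multiplies the weight by factors whose sum over the representatives is 1, because
    the active coordinates form an initial segment. *)
Lemma sum_leaves (a0 : D) delta n u : 0 <= delta ->
  \sum_(v <- leaves delta n u) box_weight delta v = box_weight delta u.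
Proof.
move=> d0; elim: n => [|n IH]; first by rewrite big_seq1.
rewrite big_allpairs_dep -IH; apply: eq_bigr => v _.
under eq_bigr do rewrite box_weight_rcons.
by rewrite -big_distrr /= sum_reps ?mulr1 //; exact: active_tau_closed.
Qed.

(** With threshold 0 no coordinate is ever frozen. *)
Lemma box_weight0 w : box_weight 0 w = \prod_(a <- w) tau_weight Phi tau beta a.
Proof.
elim/last_ind: w => [|w a IH].
  by rewrite big_nil /box_weight big1 // => j _; rewrite powR1.
rewrite box_weight_rcons IH -cats1 big_cat big_seq1; congr (_ * _).
by apply: eq_bigl => j; rewrite /active stopped_gt0.
Qed.

Lemma tau_weight_gt0 a : 0 < tau_weight Phi tau beta a.
Proof. by apply: prodr_gt0 => j _; apply: powR_gt0; exact: ratio_gt0. Qed.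

(** Distinct letters give distinct maps, so for the full set of coordinates every letter represents
    itself. *)
Lemma sum_tau_weight (a0 : D) : \sum_(a : D) tau_weight Phi tau beta a = 1.
Proof.
rewrite -(sum_reps a0 tau_closed_true) -big_enum; apply: perm_big.
apply: uniq_perm; rewrite ?enum_uniq ?reps_uniq // => a.
rewrite mem_enum mem_reps; apply/esym/eqP; apply: (Phi_inj ifsPhi).
by apply/esym/ffunP => i; move/agreeP: (rep_agree xpredT a); exact.
Qed.

End Leaves.

(** * Euclidean packings *)

Lemma pigeonhole_count (C : finType) (S : eqType) (c0 : C) (s : seq S)
    (rho : S -> C) :
  exists c, (size s <= #|C| * count (fun v => rho v == c) s)%N.
Proof.
have [c _ cmax] := @arg_maxnP C c0 xpredT
  (fun c => count (fun v => rho v == c) s) isT.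
exists c; rewrite -sum1_size (partition_big rho xpredT) //= -sum_nat_const.
by apply: leq_sum => c' _; rewrite sum1_count; exact: cmax.
Qed.

Section Euclid.
Context {R : realType} {d : nat}.
Implicit Types x y : 'rV[R]_d.

Lemma coord_le_euclid x y i : `|x ord0 i - y ord0 i| <= euclid x y.
Proof.
rewrite -sqrtr_sqr /euclid ler_wsqrtr // (bigD1 i) //= lerDl.
by apply: sumr_ge0 => j _; exact: sqr_ge0.
Qed.

Lemma euclid_le (e : R) x y : 0 <= e ->
  (forall i, `|x ord0 i - y ord0 i| <= e) -> euclid x y <= d%:R * e.
Proof.
move=> e0 h; rewrite -[leRHS]ger0_norm ?mulr_ge0 // -sqrtr_sqr ler_wsqrtr //.
apply: (@le_trans _ _ (\sum_(i < d) e ^+ 2)).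
  apply: ler_sum => i _; rewrite -(real_normK (num_real _)).
  by rewrite ler_pXn2r // nnegrE.
rewrite sumr_const card_ord exprMn -[leLHS]mulr_natl ler_wpM2r ?sqr_ge0 //.
by rewrite -natrX ler_nat; case: (d) => // n; rewrite expnS leq_pmulr.
Qed.

Lemma euclid_xx x : euclid x x = 0.
Proof. by rewrite /euclid big1 ?sqrtr0 // => i _; rewrite subrr expr0n. Qed.

(** Two centres in one piece would be less than [delta] apart, and the second would lie in both
    balls. *)
Lemma packing_number_le (S : eqType) (s : seq S) (P : S -> 'rV[R]_d -> Prop)
    (X A : set 'rV[R]_d) (delta : R) : 0 < delta -> A `<=` X ->
  (forall x, A x -> exists2 v, v \in s & P v x) ->
  (forall v x y, P v x -> P v y -> euclid x y < delta) ->
  (packing_number (@euclid R d) X A delta <= (size s)%:R%:E)%E.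
Proof.
move=> delta0 AX cov sm; apply: ge_ereal_sup => _ [n [c [cA tr]] <-].
rewrite lee_fin ler_nat.
have /choice [f fP] : forall i, exists v, v \in s /\ P v (c i).
  by move=> i; have [v vs Pv] := cov _ (cA i); exists v.
have finj : injective f.
  move=> i k fik; apply: tr => //; exists (c k); split; split.
  - exact/AX/cA.
  - by apply: (sm (f i)); [exact: (fP i).2|rewrite fik; exact: (fP k).2].
  - exact/AX/cA.
  - by rewrite euclid_xx.
rewrite -[n in (n <= _)%N]card_ord cardE -(size_map f); apply: uniq_leq_size.
  by rewrite map_inj_uniq ?enum_uniq.
by move=> _ /mapP[i _ ->]; exact: (fP i).1.
Qed.

(** Colour each point by the residues modulo [K.+1] of its grid index [g v] and keep the most
    frequent of the [K.+1 ^ d] colours. Two kept points have indices differing by at least [K.+1] in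
    some coordinate, so their grid points are at least [4 * delta] apart there, too far for the
    balls to meet. *)
Lemma packing_number_ge (S : eqType) (s : seq S) (x : S -> 'rV[R]_d)
    (g : S -> 'I_d -> int) (K : nat) (h delta : R) (X A : set 'rV[R]_d) :
  uniq s -> 0 < h -> 4 * delta <= K.+1%:R * h ->
  (forall v, v \in s -> A (x v)) ->
  (forall v w, v \in s -> w \in s -> g v =1 g w -> v = w) ->
  (forall v i, v \in s -> `|x v ord0 i - h * (g v i)%:~R| <= delta) ->
  exists2 n, (size s <= K.+1 ^ d * n)%N &
    (n%:R%:E <= packing_number (@euclid R d) X A delta)%E.
Proof.
move=> us h0 hK xA ginj xg.
pose rho v := [ffun i : 'I_d => inord `|(g v i %% K.+1)%Z|%N : 'I_K.+1].
have [c] := pigeonhole_count [ffun=> ord0] s rho.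
rewrite card_ffun !card_ord => hc; exists (count (fun v => rho v == c) s) => //.
apply: ereal_sup_ubound => /=; exists (count (fun v => rho v == c) s) => //.
rewrite -size_filter; set t := seq.filter _ s.
have ut : uniq t by rewrite filter_uniq.
have tP v : v \in t -> rho v = c /\ v \in s.
  by rewrite mem_filter => /andP[/eqP].
exists (fun i : 'I_(size t) => x (tnth (in_tuple t) i)); split.
  by move=> i; apply: xA; have [] := tP _ (mem_tnth i (in_tuple t)).
move=> i k _ _ [z [[_ iz] [_ kz]]]; move: (mem_tnth i (in_tuple t)) (mem_tnth k (in_tuple t)) iz kz.
suff key v w : v \in t -> w \in t -> euclid (x v) z < delta ->
    euclid (x w) z < delta -> v = w.
  move=> hi hk iz kz; apply: (elimT (tuple_uniqP (in_tuple t)) ut).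
  exact: key.
move=> /tP[rv vs] /tP[rw ws] vz wz; apply: ginj => // j; apply/eqP/negPn/negP => ne.
have dv : ((K.+1 : int) %| g v j - g w j)%Z.
  rewrite -eqz_mod_dvd.
  have := congr1 (fun f : {ffun 'I_d -> 'I_K.+1} => val (f j)) (etrans rv (esym rw)).
  have K0 (m : int) : (`|(m %% K.+1)%Z| < K.+1)%N.
    rewrite -ltz_nat gez0_abs ?modz_ge0 //; exact: ltz_pmod.
  rewrite !ffunE /= !inordK // => e; apply/eqP.
  by rewrite -[LHS]gez0_abs ?modz_ge0 // e gez0_abs ?modz_ge0.
have : K.+1%:R <= `|(g v j)%:~R - (g w j)%:~R| :> R.
  rewrite -intrB -intr_norm -[K.+1%:R]/(K.+1%:Z%:~R) ler_int.
  have : (0 < `|g v j - g w j|)%N by rewrite absz_gt0 subr_eq0.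
  by move=> /dvdn_leq; rewrite dvdzE in dv => /(_ _ dv).
have := xg v j vs; have := xg w j ws.
have := le_lt_trans (coord_le_euclid (x v) z j) vz.
have := le_lt_trans (coord_le_euclid (x w) z j) wz.
move: (x v ord0 j) (x w ord0 j) (z ord0 j) => a b e.
move: ((g v j)%:~R : R) ((g w j)%:~R : R) => p q.
rewrite !ltr_norml !ler_norml => /andP[h1 h2] /andP[h3 h4] /andP[h5 h6] /andP[h7 h8].
rewrite -(ler_pM2r h0) => h9; have := le_trans hK h9.
rewrite -[X in _ <= _ * X](gtr0_norm h0) -normrM mulrBl leNgt => /negP; apply.
by rewrite ltr_norml; apply/andP; split; lra.
Qed.

End Euclid.

(** The loss is a factor [r] to the power [|b|]; the absolute value covers both signs of the
    exponent. *)
Lemma powR_near {R : realType} (r delta s b : R) : 0 < r -> 0 < delta ->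
  r * delta < s -> s <= delta ->
  expR (`|b| * ln r) * delta `^ b <= s `^ b <= expR (- (`|b| * ln r)) * delta `^ b.
Proof.
move=> r0 d0 rs sd; have s0 : 0 < s by apply: lt_trans rs; exact: mulr_gt0.
have h1 : ln r + ln delta <= ln s by rewrite -lnM ?posrE // ler_ln ?posrE ?mulr_gt0 // ltW.
have h2 : ln s <= ln delta by rewrite ler_ln ?posrE.
rewrite /powR !gt_eqF // -!expRD !ler_expR; move: (ln r) (ln delta) (ln s) h1 h2 => x y z h1 h2.
by case: (ler0P b) => hb; nra.
Qed.

Lemma prod_powR {R : realType} (I : finType) (a : R) (b : I -> R) : 0 < a ->
  \prod_i a `^ b i = a `^ (\sum_i b i).
Proof.
move=> a0; apply/esym; apply: (big_morph (powR a)); last exact: powRr0.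
by move=> x y; rewrite powRD // (gt_eqF a0) /= implybT.
Qed.

(** * Packing numbers of cylinders *)

Section CylinderPacking.
Context {R : realType} {d : nat} {D : finType}.
Variables (Phi : D -> {ffun 'I_d -> R * R}) (E : set 'rV[R]_d).
Variables (tau : 'S_d) (beta : 'I_d -> R).
Hypothesis d_gt0 : (0 < d)%N.
Hypothesis ifsPhi : diagonal_ifs Phi.
Hypothesis attE : attractor Phi E.
Hypothesis order : coordinate_ordering Phi tau.
Hypothesis neat : neat_projection Phi tau.
Hypothesis betaP : beta_sequence Phi tau beta.

Lemma attractor_letter : inhabited D.
Proof.
case: attE => -[x Ex] _ _ EE; move: Ex; rewrite EE => -[a _ _].
exact: inhabits a.
Qed.

Lemma word_map_attractor w : word_map Phi w @` E `<=` E.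
Proof.
elim: w => [|a w IH] _ [x Ex <-] //; case: attE => _ _ _ ->.
by exists a => //; exists (word_map Phi w x) => //; apply: IH; exists x.
Qed.

(** Ensures that no coordinate freezes along [u], so that its stopped box is the box of the whole
    map [word_map Phi u]. *)
Definition below_word (delta : R) (u : seq D) :=
  0 < delta < 1 /\ forall i, delta < (stopped Phi 0 i u).1.

(** Every leaf has weight comparable to [delta] to the power of the sum of the [beta j], and these
    weights add up to the weight of [u]. The constants depend neither on [delta] nor on [u]. *)
Lemma leaves_count : exists (r C : R), [/\ 0 < r, 0 < C &
  forall delta u, below_word delta u -> exists n, [/\
    forall v i, v \in leaves Phi delta n u ->
      r * delta < (stopped Phi delta i v).1 <= delta,
    (size (leaves Phi delta n u))%:R * delta `^ (\sum_j beta j) <=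
      C * box_weight Phi tau beta 0 u &
    box_weight Phi tau beta 0 u <=
      C * ((size (leaves Phi delta n u))%:R * delta `^ (\sum_j beta j))]].
Proof.
have [a0] := attractor_letter.
have [r r01 hr] := ratio_bound ifsPhi; have [r0 r1] := andP r01.
pose C : R := \prod_(j < d) expR (- (`|beta j| * ln r)).
have C0 : 0 < C by apply: prodr_gt0 => j _; exact: expR_gt0.
exists r, C; split => // delta u [d01 du]; have [d0 d1] := andP d01.
have [n hn] := stopped_small ifsPhi r01 d0 (fun a i => (andP (hr a i)).2).
exists n.
have hv v i : v \in leaves Phi delta n u ->
    r * delta < (stopped Phi delta i v).1 <= delta.
  move=> /leaves_cat[w -> sw]; apply/andP; split.
    by apply: stopped_gt_ratio => // a k; case/andP: (hr a k).
  by apply: hn; rewrite size_cat sw leq_addl.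
have W0 : box_weight Phi tau beta 0 u =
    \sum_(v <- leaves Phi delta n u) box_weight Phi tau beta delta v.
  rewrite sum_leaves //; last exact: ltW.
  by apply: eq_bigr => j _; rewrite (@stopped_eq0 _ _ _ _ _ delta) // ltW.
have Wv v : v \in leaves Phi delta n u ->
    C^-1 * delta `^ (\sum_j beta j) <= box_weight Phi tau beta delta v <=
    C * delta `^ (\sum_j beta j).
  move=> vl; rewrite -prod_powR // /C -prodfV -!big_split /=.
  have near j := powR_near (beta j) r0 d0 (andP (hv v (tau j) vl)).1
    (andP (hv v (tau j) vl)).2.
  apply/andP; split; apply: ler_prod => j _; have /andP[h1 h2] := near j.
    by rewrite -expRN opprK h1 mulr_ge0 ?expR_ge0 ?powR_ge0.
  by rewrite h2 powR_ge0.
have sumc (x : R) : \sum_(v <- leaves Phi delta n u) x =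
    (size (leaves Phi delta n u))%:R * x.
  by rewrite big_const_seq count_predT iter_addr_0 mulr_natl.
split => //.
- rewrite -ler_pdivrMl // mulrCA -sumc W0 big_seq [leRHS]big_seq.
  by apply: ler_sum => v vl; case/andP: (Wv v vl).
- rewrite mulrCA -sumc W0 big_seq [leRHS]big_seq.
  by apply: ler_sum => v vl; case/andP: (Wv v vl).
Qed.

(* The integer [g v i] is the index of a point of the grid of mesh [r delta]
   inside the open [i]-th side of the box of the leaf [v]. *)
Lemma leaves_packing (r delta : R) n u : 0 < r -> 0 < delta ->
  (forall v i, v \in leaves Phi delta n u ->
      r * delta < (stopped Phi delta i v).1 <= delta) ->
  exists2 m, (size (leaves Phi delta n u) <= (Num.bound (4 / r)).+1 ^ d * m)%N &
  (m%:R%:E <= packing_number (@euclid R d) E (word_map Phi u @` E) delta)%E.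
Proof.
move=> r0 d0 hv; have h0 : 0 < r * delta by exact: mulr_gt0.
have [[e Ee] _ E01 _] := attE.
pose g v i : int := Num.floor ((stopped Phi delta i v).2 / (r * delta)) + 1.
have gP v i : v \in leaves Phi delta n u ->
    (stopped Phi delta i v).2 < r * delta * (g v i)%:~R <
    (stopped Phi delta i v).1 + (stopped Phi delta i v).2.
  move=> vl; have /andP[h1 h2] := hv v i vl.
  rewrite mulrC -ltr_pdivrMr // floorD1_gt /=.
  have := floor_le ((stopped Phi delta i v).2 / (r * delta)).
  rewrite ler_pdivlMr // /g intrD mulrDl mul1r; lra.
apply: (@packing_number_ge _ _ _ _ (fun v => word_map Phi v e) g _ (r * delta)) => //.
- exact: leaves_uniq.
(* The bound exceeds [4 / r], so that many meshes of size [r * delta] span [4 * delta]. *)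
- rewrite mulrA ler_pM2r // -ler_pdivrMr //.
  have /ltW/le_trans := archi_boundP (ltW (divr_gt0 (ltr0n R 4) r0)).
  by apply; rewrite ler_nat.
- move=> v /leaves_cat[w -> _]; exists (word_map Phi w e).
    by apply: word_map_attractor; exists e.
  by rewrite word_map_cat.
(* Equal indices would give a grid value interior to both sides in every coordinate, against the
   separation of distinct leaves. *)
- move=> v w vl wl gvw; apply/eqP/negPn/negP => /(separate_leaves ifsPhi order neat (ltW d0) vl wl).
  move=> [i]; have := gP v i vl; have := gP w i wl; rewrite gvw.
  by move=> /andP[h1 h2] /andP[h3 h4] [h|h]; lra.
- move=> v i vl; have := in_box_word ifsPhi v (ltW d0) (E01 _ Ee) i.
  have := gP v i vl; have := hv v i vl; rewrite ler_norml; lra.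
Qed.

(** The lower bound packs balls at the leaves of scale [delta], losing the number [K] of colours;
    the upper bound covers by leaves of a finer scale, losing the factor [L]. The sum of both
    constants serves for either side. *)
Lemma cylinder_packing : exists2 M : R, 0 < M &
  forall delta u, below_word delta u ->
  ((M^-1 * box_weight Phi tau beta 0 u)%:E <=
   packing_number (@euclid R d) E (word_map Phi u @` E) delta *
   (delta `^ (\sum_j beta j))%:E <=
   (M * box_weight Phi tau beta 0 u)%:E)%E.
Proof.
have [r [C [r0 C0 hC]]] := leaves_count.
set B := \sum_j beta j in hC *.
have dR0 : 0 < (2 * d)%:R :> R by rewrite ltr0n muln_gt0.
pose K : R := ((Num.bound (4 / r)).+1 ^ d)%:R.
have K0 : 0 < K by rewrite ltr0n expn_gt0.
pose L := (2 * d)%:R `^ B : R; have L0 : 0 < L by exact: powR_gt0.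
exists (C * K + C * L); first by rewrite addr_gt0 // mulr_gt0.
move=> delta u du; have [d01 dlt] := du; have [d0 d1] := andP d01.
have W0 : 0 < box_weight Phi tau beta 0 u.
  by apply: prodr_gt0 => j _; rewrite powR_gt0 // stopped_gt0.
set W := box_weight _ _ _ _ _ in W0 *.
have P0 : 0 < delta `^ B by exact: powR_gt0.
have PE : (0 <= (delta `^ B)%:E)%E by rewrite lee_fin ltW.
apply/andP; split.
  have [n [hv _ hW]] := hC _ _ du.
  have [m sm] := leaves_packing r0 d0 hv.
  move=> /(lee_wpmul2r PE).
  apply: le_trans; rewrite -EFinM lee_fin ler_pdivrMl ?addr_gt0 ?mulr_gt0 //.
  apply: (le_trans hW); rewrite mulrDl.
  apply: (@le_trans _ _ (C * K * (m%:R * delta `^ B))); last first.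
    by rewrite lerDl !mulr_ge0 // ltW.
  rewrite -mulrA ler_pM2l // mulrA ler_pM2r // -natrM ler_nat.
  exact: sm.
(* A box with sides at most [eps] has Euclidean diameter at most [d * eps = delta / 2]. *)
pose eps := delta / (2 * d)%:R.
have epsd : eps <= delta.
  by rewrite ler_pdivrMr // ler_peMr ?ler1n ?muln_gt0 // ltW.
have eps0 : 0 < eps by rewrite divr_gt0.
have ue : below_word eps u.
  split; first by rewrite eps0 (le_lt_trans epsd).
  by move=> i; exact: le_lt_trans epsd (dlt i).
have [n [hv hW _]] := hC _ _ ue.
have : (packing_number (@euclid R d) E (word_map Phi u @` E) delta <=
        (size (leaves Phi eps n u))%:R%:E)%E.
  apply: (packing_number_le (P := fun v x => v \in leaves Phi eps n u /\ in_box Phi eps v x)) => //.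
  - exact: word_map_attractor.
  - move=> x ux; have [v vl vx] := leaves_cover ifsPhi n attE (ltW eps0) ux.
    by exists v.
  - move=> v x y [vl vx] [_ vy]; apply: (@le_lt_trans _ _ (d%:R * eps)).
      apply: euclid_le; first exact: ltW.
      move=> i; have := vx i; have := vy i; have := hv v i vl.
      by rewrite ler_norml; lra.
    have dn : (d%:R : R) != 0 by rewrite pnatr_eq0 -lt0n.
    have -> : d%:R * eps = delta / 2 by rewrite /eps natrM; field.
    lra.
move=> /(lee_wpmul2r PE).
move=> /le_trans; apply; rewrite -EFinM lee_fin.
have -> : delta `^ B = L * eps `^ B.
  by rewrite -powRM ?ltW // mulrC divfK // gt_eqF.
rewrite mulrCA mulrDl; apply: (@le_trans _ _ (C * L * W)); last first.
  by rewrite lerDr !mulr_ge0 // ltW.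
by rewrite (mulrC C) -mulrA ler_pM2l.
Qed.

End CylinderPacking.

(** * Box dimension *)

(** Taking logarithms and dividing by [- ln delta] squeezes the quotient between [B] plus and minus
    [ln M / ln delta]. *)
Lemma has_box_dim_of_bounds {R : realType} {T : Type} (dist : T -> T -> R)
    (X : set T) (B M : R) : 0 < M ->
  (forall delta, 0 < delta < 1 ->
    (M^-1%:E <= packing_number dist X X delta * (delta `^ B)%:E <= M%:E)%E) ->
  has_box_dim dist X B.
Proof.
move=> M0 hM; rewrite /has_box_dim.
have inv_ln_cvg : (fun delta : R => (ln delta)^-1) delta @[delta --> 0^'+] --> (0 : R).
  apply/ltr0_cvgV0; last exact: lnNy.
  near=> delta; rewrite ln_lt0 //; apply/andP; split; near: delta.
    exact: nbhs_right_gt.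
  exact: nbhs_right_lt.
have side (c : R) : ((B + c * (ln delta)^-1)%:E : \bar R) @[delta --> 0^'+] --> B%:E.
  apply: cvg_EFin; first exact: nearW.
  rewrite -[X in _ --> X]addr0 -[X in _ --> _ + X](mulr0 c).
  by apply: cvgD; [exact: cvg_cst | apply: cvgMr].
apply: squeeze_cvge (side (ln M)) (side (- ln M)).
near=> delta.
have d0 : 0 < delta by near: delta; exact: nbhs_right_gt.
have d1 : delta < 1 by near: delta; exact: nbhs_right_lt.
have ld : ln delta < 0 by rewrite ln_lt0 // d0.
have := hM _ (introT andP (conj d0 d1)).
have P0 : 0 < delta `^ B by exact: powR_gt0.
(* The two bounds exclude infinite values and force a finite value to be positive, so its logarithm
   is real. *)
case: (packing_number _ _ _ _) => [n| |].
- rewrite -EFinM !lee_fin => /andP[h1 h2].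
  have n0 : 0 < n by rewrite -(pmulr_lgt0 _ P0) (lt_le_trans _ h1) // invr_gt0.
  rewrite lne_EFin // -EFinM !lee_fin.
  move: h1 h2; rewrite -ler_ln ?posrE ?invr_gt0 ?mulr_gt0 // lnM ?posrE // lnV ?posrE // ln_powR.
  rewrite -[_ <= M]ler_ln ?posrE ?mulr_gt0 // lnM ?posrE // ln_powR => h1 h2.
  rewrite invrN; set k := (ln delta)^-1.
  have k0 : k < 0 by rewrite invr_lt0.
  have kl : k * ln delta = 1 by rewrite mulVf // lt_eqF.
  have kD : k * (ln n + B * ln delta) = k * ln n + B.
    by rewrite mulrDr mulrCA kl mulr1.
  have := ler_wnM2l (ltW k0) h1; have := ler_wnM2l (ltW k0) h2.
  by rewrite kD => h3 h4; apply/andP; split; lra.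
- by rewrite gt0_mulye ?lte_fin // => /andP[_]; rewrite leye_eq.
- by rewrite gt0_mulNye ?lte_fin // => /andP[]; rewrite leeNy_eq.
Unshelve. all: by end_near. Qed.

Section BoxDim.
Context {R : realType} {d : nat} {D : finType}.
Variables (Phi : D -> {ffun 'I_d -> R * R}) (E : set 'rV[R]_d).
Variables (tau : 'S_d) (beta : 'I_d -> R).
Hypothesis d_gt0 : (0 < d)%N.
Hypothesis ifsPhi : diagonal_ifs Phi.
Hypothesis attE : attractor Phi E.
Hypothesis order : coordinate_ordering Phi tau.
Hypothesis neat : neat_projection Phi tau.
Hypothesis betaP : beta_sequence Phi tau beta.

(** The case of the empty word: its cylinder is [E] and its weight the empty product. *)
Lemma attractor_box_dim : has_box_dim (@euclid R d) E (\sum_j beta j).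
Proof.
have [M M0 hM] := cylinder_packing d_gt0 ifsPhi attE order neat betaP.
apply: (@has_box_dim_of_bounds _ _ _ _ _ M) => // delta d01.
have := hM delta [::]; rewrite box_weight0 // big_nil !mulr1 image_id; apply.
by split => // i; case/andP: d01.
Qed.

End BoxDim.

(** * The covering by cylinders *)

Lemma cvg_row {R : realType} {d : nat} {T : Type} (F : set_system T)
    {FF : Filter F} (f : T -> 'rV[R]_d) (l : 'rV[R]_d) :
  (forall i, f t ord0 i @[t --> F] --> l ord0 i) -> f t @[t --> F] --> l.
Proof.
move=> fl; apply/cvg_ballP => e e0.
have : \forall t \near F, forall i, ball (l ord0 i) e (f t ord0 i).
  by apply: filter_forall => i; move/cvg_ballP: (fl i); exact.
by apply: filterS => t ht; split => // i j; rewrite ord1.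
Qed.

Lemma card_le_finType {T : Type} {C : finType} (S : set T) (f : T -> C) :
  {in S &, injective f} -> (S #<= `I_#|C|)%card.
Proof.
move=> finj.
(* Points outside [S] get the value [#|C|], just beyond the target, so that [S] becomes a
   preimage. *)
pose g x := if `[< S x >] then nat_of_ord (enum_rank (f x)) else #|C|.
have gS x : (g x < #|C|)%N -> S x.
  by rewrite /g; case: asboolP => //; rewrite ltnn.
have -> : S = g @^-1` `I_#|C|.
  apply/seteqP; split => x /=; last exact: gS.
  by move=> Sx; rewrite /g asboolT //.
apply: card_ge_preimage => x y; rewrite !inE => /gS Sx /gS Sy.
rewrite /g !asboolT // => /val_inj /enum_rank_inj; apply: finj; exact: mem_set.
Qed.

Lemma aff_continuous {R : realType} (f : R * R) : continuous (aff f).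
Proof.
by move=> x; apply: cvgD; [apply: cvgMr; exact: cvg_id|exact: cvg_cst].
Qed.

Section Covering.
Context {R : realType} {d : nat} {D : finType}.
Variables (Phi : D -> {ffun 'I_d -> R * R}) (E : set 'rV[R]_d).
Hypothesis ifsPhi : diagonal_ifs Phi.
Hypothesis attE : attractor Phi E.

Lemma diag_map_continuous (f : {ffun 'I_d -> R * R}) :
  continuous (diag_map f : 'rV[R]_d -> 'rV[R]_d).
Proof.
move=> x; apply: (@cvg_row _ _ _ _ (nbhs_filter x)) => i; rewrite mxE.
under eq_fun do rewrite mxE.
apply: (@continuous_comp _ _ _ (fun y : 'rV[R]_d => y ord0 i) (aff (f i))).
  exact: coord_continuous.
exact: aff_continuous.
Qed.

Lemma word_map_continuous w : continuous (word_map Phi w : 'rV[R]_d -> 'rV[R]_d).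
Proof.
elim: w => [|a w IH] x /=; first exact: cvg_id.
apply: continuous_comp; first exact: IH.
exact: diag_map_continuous.
Qed.

Lemma cylinder_compact w : compact (word_map Phi w @` E).
Proof.
apply: continuous_compact; last by case: attE.
by apply: continuous_subspaceT; exact: word_map_continuous.
Qed.

Lemma cylinders_cover k : \bigcup_(A in cylinders Phi E k) A = E.
Proof.
apply/seteqP; split => [x [_ [w _ <-]]|]; first exact: word_map_attractor.
elim: k => [|k IH] x Ex; first by exists E => //; exists [tuple]; rewrite //= image_id.
case: attE (Ex) => _ _ _ {1}-> [a _ [y /IH[_ [w _ <-] [z Ez <-]] <-]].
exists (word_map Phi (a :: w) @` E); first by exists (cons_tuple a w).
by exists z.
Qed.

Variable tau : 'S_d.
Hypothesis neat : neat_projection Phi tau.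

(* A box containing [x] contains a one-sided neighbourhood of [x] in each
   coordinate; two boxes with disjoint interiors must differ in these sides. *)
Lemma cylinders_multiplicity k x :
  ([set A | cylinders Phi E k A /\ A x] #<= `I_#|{ffun 'I_d -> bool}|)%card.
Proof.
have [_ _ E01 _] := attE.
have [a0] := attractor_letter attE.
have /choice[f fP] : forall A, exists w : k.-tuple D,
    cylinders Phi E k A -> word_map Phi w @` E = A.
  move=> A; have [[w _ wA]|nA] := pselect (cylinders Phi E k A).
    by exists w.
  by exists (nseq_tuple k a0).
(* If two intervals without common interior both contain [x], it is the upper end of one and the
   lower end of the other, so the bits differ there. *)
apply: (@card_le_finType _ _ _ (fun A => [ffun i => x ord0 i <
  (stopped Phi 0 i (f A)).1 + (stopped Phi 0 i (f A)).2])) => A B.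
rewrite !inE => -[cA Ax] [cB Bx] /ffunP sAB.
rewrite -(fP A cA) -(fP B cB); congr (word_map Phi _ @` E).
apply/eqP/negPn/negP => ne.
have sz : size (f A) = size (f B) by rewrite !size_tuple.
have [i [_ dj]] := separate_words ifsPhi neat sz ne.
have box C : cylinders Phi E k C -> C x -> in_box Phi 0 (f C) x.
  by move=> cC; rewrite -{1}(fP C cC) => -[e Ee <-]; apply: in_box_word (E01 _ Ee).
have := sAB i; rewrite !ffunE => sAi.
have := stopped_gt0 ifsPhi 0 i (f A); have := stopped_gt0 ifsPhi 0 i (f B).
have /andP[] := box A cA Ax i; have /andP[] := box B cB Bx i; case: dj sAi.
  case: ltP => h1; case: ltP => h2 //; lra.
case: ltP => h1; case: ltP => h2 //; lra.
Qed.

Lemma cylinders_diam :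
  ereal_sup [set diam (@euclid R d) A | A in cylinders Phi E k] @[k --> \oo]
    --> (0 : \bar R).
Proof.
have [a0] := attractor_letter attE; have [[e Ee] _ E01 _] := attE.
have [r r01 hr] := ratio_bound ifsPhi.
have geo : ((d%:R * (1 - r) ^+ k)%:E : \bar R) @[k --> \oo] --> (0 : \bar R).
  apply: cvg_EFin; first exact: nearW.
  rewrite -[X in _ --> X](mulr0 (d%:R : R)); apply: cvgMr.
  by apply: cvg_expr; rewrite ger0_norm; lra.
apply: (@squeeze_cvge _ _ _ R (fun=> 0%E) _
  (fun k => (d%:R * (1 - r) ^+ k)%:E)); [|exact: cvg_cst|exact: geo].
apply: nearW => k; apply/andP; split.
  (* The supremum of an empty set would be minus infinity, so an actual cylinder and a pair of equal
     points in it are exhibited. *)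
  apply: ereal_sup_ge; exists (diam (@euclid R d) (word_map Phi (nseq k a0) @` E)).
    by exists (word_map Phi (nseq k a0) @` E) => //; exists (nseq_tuple k a0).
  pose y := word_map Phi (nseq k a0) e.
  apply: ereal_sup_ge; exists (euclid y y)%:E; last by rewrite euclid_xx.
  by exists (y, y) => //; split; exists e.
apply: ge_ereal_sup => _ [_ [w _ <-] <-]; apply: ge_ereal_sup => _ [[x y] /= [wx wy] <-].
rewrite lee_fin; apply: euclid_le; first by rewrite exprn_ge0; lra.
move=> i; have hw := stopped0_geo ifsPhi i w r01 (fun a i => (andP (hr a i)).2).
rewrite size_tuple in hw.
case: wx wy => [x' Ex <-] [y' Ey <-].
have := in_box_word ifsPhi w (lexx 0) (E01 _ Ex) i.
have := in_box_word ifsPhi w (lexx 0) (E01 _ Ey) i.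
by rewrite ler_norml; lra.
Qed.

Lemma cylinders_vitali : compact_vitali_covering (@euclid R d) E (cylinders Phi E).
Proof.
split.
- by move=> k _; exact: cylinders_cover.
- by move=> k _ _ [w _ <-]; exact: cylinder_compact.
- by exists #|{ffun 'I_d -> bool}| => k x _ _; exact: cylinders_multiplicity.
- exact: cylinders_diam.
Qed.

End Covering.

(** * Codes avoiding a letter *)

Lemma code_cylinder_measurable {D : finType} (a0 : D) w :
  measurable (code_cylinder w : set (code_measurable a0)).
Proof. by apply: sub_sigma_algebra; exists w. Qed.

Lemma measure_bigsetU_le {d0} {T : measurableType d0} {R : realType}
    (mu : {measure set T -> \bar R}) (I : Type) (s : seq I) (F : I -> set T) :
  (forall i, measurable (F i)) ->
  (mu (\big[setU/set0]_(i <- s) F i) <= \sum_(i <- s) mu (F i))%E.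
Proof.
move=> mF; elim: s => [|i s IH]; first by rewrite !big_nil measure0.
rewrite !big_cons; apply: le_trans (measureU2 _ _ _) _ => //.
  exact: bigsetU_measurable.
exact: leeD2l.
Qed.

Section AvoidLetter.
Context {R : realType} {D : finType}.
Variables (p : D -> R) (a0 : D) (nu : probability (code_measurable a0) R).
Hypothesis p_gt0 : forall a, 0 < p a.
Hypothesis p_sum : \sum_a p a = 1.
Hypothesis nuP : product_measure p nu.
Variables (c : D) (k : nat).

Let letters n := if (n < k)%N then enum D else [seq a <- enum D | a != c].

Fixpoint avoiding n : seq (seq D) :=
  if n is n'.+1 then [seq rcons v a | v <- avoiding n', a <- letters n'] else [:: [::]].

Lemma mem_avoiding (omega : nat -> D) n :
  (forall m, (k <= m)%N -> omega m != c) -> mkseq omega n \in avoiding n.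
Proof.
move=> oc; elim: n => [|n IH] //; rewrite mkseqS.
apply/allpairsPdep; exists (mkseq omega n), (omega n); split => //.
rewrite /letters; case: ltnP => [_|kn]; first by rewrite mem_enum.
by rewrite mem_filter mem_enum oc.
Qed.

Lemma avoidingP (omega : nat -> D) n m : mkseq omega n \in avoiding n ->
  (k <= m < n)%N -> omega m != c.
Proof.
elim: n => [|n IH]; first by rewrite ltn0 andbF.
rewrite mkseqS => /allpairsPdep[v [a [vl al /rcons_inj[ev ea]]]].
rewrite ltnS [(m <= n)%N]leq_eqVlt => /andP[km /orP[/eqP mn|mn]];
  last by apply: IH; rewrite ?ev ?km.
move: al; rewrite mn ea /letters ltnNge -mn km /= mem_filter.
by case/andP.
Qed.

(** Each position before [k] contributes the total mass 1, each later one the mass of the letters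
    other than [c]; truncated subtraction gives exponent 0 up to [k]. *)
Lemma sum_avoiding n : \sum_(v <- avoiding n) \prod_(a <- v) p a =
  (\sum_(a | a != c) p a) ^+ (n - k).
Proof.
elim: n => [|n IH]; first by rewrite big_seq1 big_nil sub0n expr0.
rewrite /= big_allpairs_dep.
under eq_bigr => v _ do under eq_bigr => a _ do rewrite -cats1 big_cat big_seq1.
under eq_bigr => v _ do rewrite -big_distrr /=.
rewrite -big_distrl /= IH /letters; case: ltnP => nk.
  rewrite big_enum p_sum mulr1.
  by have -> : (n.+1 - k = n - k)%N by lia.
by rewrite big_filter big_enum_cond subSn // exprSr.
Qed.

Definition avoid_letter : set (code_measurable a0) :=
  [set omega | forall m, (k <= m)%N -> omega m != c].

Let cover n : set (code_measurable a0) :=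
  \big[setU/set0]_(v <- avoiding n) (code_cylinder v : set (code_measurable a0)).

Lemma coverP n omega : cover n omega <-> mkseq omega n \in avoiding n.
Proof.
have sz v : v \in avoiding n -> size v = n.
  elim: n v => [|n IH] v; first by rewrite inE => /eqP ->.
  by move=> /allpairsPdep[w [a [wl _ ->]]]; rewrite size_rcons IH.
rewrite /cover -bigcup_seq; split => [[v /= vl]|ol].
  move=> h; have : mkseq omega (size v) = v := h; rewrite (sz v vl) => ->.
  by [].
by exists (mkseq omega n) => //=; rewrite /code_cylinder /= size_mkseq.
Qed.

(** A countable intersection of finite unions of code cylinders, which gives measurability. *)
Lemma avoid_letterE : avoid_letter = \bigcap_n cover n.
Proof.
apply/seteqP; split => omega /= h.
  by move=> n _; apply/coverP; exact: mem_avoiding.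
move=> m km; have /coverP := h m.+1 I; move=> /avoidingP; apply.
by rewrite km /=.
Qed.

Lemma cover_measurable n : measurable (cover n).
Proof. by apply: bigsetU_measurable => v _; exact: code_cylinder_measurable. Qed.

Lemma avoid_letter_measurable : measurable avoid_letter.
Proof.
rewrite avoid_letterE; apply: bigcapT_measurable => n; exact: cover_measurable.
Qed.

(** Prefixes of length [k + n] cover the event with mass [q ^+ n], and [q < 1] because [c] has
    positive weight. *)
Lemma avoid_letter_null : nu avoid_letter = 0%E.
Proof.
set q := \sum_(a | a != c) p a.
have q01 : 0 <= q < 1.
  rewrite sumr_ge0 /=; last by move=> a _; exact: ltW.
  by rewrite -p_sum [ltRHS](bigD1 c) //= ltrDr.
have bound n : (nu avoid_letter <= (q ^+ n)%:E)%E.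
  apply: (@le_trans _ _ (nu (cover (k + n)))).
    apply: le_measure; rewrite ?inE; [exact: avoid_letter_measurable|exact: cover_measurable|].
    by rewrite avoid_letterE => omega; exact.
  apply: le_trans (measure_bigsetU_le _ _ _) _; first exact: code_cylinder_measurable.
  rewrite (eq_bigr (fun v => (\prod_(a <- v) p a)%:E)); last by move=> v _; exact: nuP.
  by rewrite sumEFin sum_avoiding addKn.
apply/eqP; rewrite eq_le measure_ge0 andbT; apply/lee_addgt0Pr => e e0.
have /cvgr0Pnorm_lt/(_ _ e0)[n _ /(_ n (leqnn n)) /=] : (fun n => q ^+ n) @ \oo --> (0 : R).
  by apply: cvg_expr; rewrite ger0_norm; case/andP: q01.
case/andP: q01 => q0 q1; rewrite ger0_norm ?exprn_ge0 // => qe.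
by rewrite add0e (le_trans (bound n)) // lee_fin ltW.
Qed.

End AvoidLetter.

(** * The coding map *)

Section Coding.
Context {R : realType} {d : nat} {D : finType}.
Variables (Phi : D -> {ffun 'I_d -> R * R}) (E : set 'rV[R]_d).
Hypothesis ifsPhi : diagonal_ifs Phi.
Hypothesis attE : attractor Phi E.
Implicit Types (omega : nat -> D) (i : 'I_d).

Lemma mkseq_prefix omega m n : (m <= n)%N ->
  exists v, mkseq omega n = mkseq omega m ++ v.
Proof.
move=> mn; exists (map omega (iota m (n - m))).
by rewrite /mkseq -map_cat -iotaD subnKC.
Qed.

Let lo omega i n := (stopped Phi 0 i (mkseq omega n)).2.

Lemma lower_end_nondecreasing omega i : nondecreasing_seq (lo omega i).
Proof.
move=> m n /(mkseq_prefix omega)[v e].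
by rewrite /lo e; exact: (stopped_nest ifsPhi 0 i _ v).1.
Qed.

Lemma lower_end_cvgn omega i : cvgn (lo omega i).
Proof.
apply: nondecreasing_is_cvgn; first exact: lower_end_nondecreasing.
exists 1 => _ [n _ <-]; have := (stopped_nest ifsPhi 0 i [::] (mkseq omega n)).2.
have := stopped_gt0 ifsPhi 0 i (mkseq omega n).
by rewrite cat0s /= /lo addr0 => h1 h2; lra.
Qed.

Lemma length_cvg0 omega i : (stopped Phi 0 i (mkseq omega n)).1 @[n --> \oo] --> 0.
Proof.
have [r r01 hr] := ratio_bound ifsPhi.
apply: (@squeeze_cvgr _ _ _ _ (fun=> 0) (fun n => (1 - r) ^+ n)).
- apply: nearW => n; rewrite ltW ?stopped_gt0 //=.
  rewrite -[n in leRHS](size_mkseq omega); apply: stopped0_geo => // a j.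
  by case/andP: (hr a j).
- exact: cvg_cst.
- by apply: cvg_expr; rewrite ger0_norm; lra.
Qed.

(** The images stay in nested boxes whose sides shrink to 0, so the limit is the same for every
    starting point of the cube, be it the origin used in [coding] or a point of [E]. *)
Lemma word_map_cvg_row omega x : unit_cube x ->
  word_map Phi (mkseq omega n) x @[n --> \oo] --> \row_i limn (lo omega i).
Proof.
move=> x01; apply: cvg_row => i; rewrite mxE.
apply: (@squeeze_cvgr _ _ _ _ (lo omega i)
    (fun n => (stopped Phi 0 i (mkseq omega n)).1 + lo omega i n)).
- by apply: nearW => n; exact: in_box_word.
- exact: lower_end_cvgn.
- rewrite -[X in _ --> X]add0r; apply: cvgD; first exact: length_cvg0.
  exact: lower_end_cvgn.
Qed.

Lemma codingE omega : coding Phi omega = \row_i limn (lo omega i).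
Proof.
apply: cvg_lim; first exact: norm_hausdorff.
by apply: word_map_cvg_row => i; rewrite mxE lexx ler01.
Qed.

Lemma word_map_cvg omega x : unit_cube x ->
  word_map Phi (mkseq omega n) x @[n --> \oo] --> coding Phi omega.
Proof. by rewrite codingE; exact: word_map_cvg_row. Qed.

Lemma coding_in_box omega n : in_box Phi 0 (mkseq omega n) (coding Phi omega).
Proof.
move=> i; rewrite codingE mxE; apply/andP; split.
  apply: nondecreasing_cvgn_le; first exact: lower_end_nondecreasing.
  exact: lower_end_cvgn.
apply: limr_le; first exact: lower_end_cvgn.
near=> m; have nm : (n <= m)%N by near: m; exact: nbhs_infty_ge.
have [v e] := mkseq_prefix omega nm; rewrite /lo e.
apply: le_trans (stopped_nest ifsPhi 0 i _ v).2.
by rewrite lerDr ltW // stopped_gt0.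
Unshelve. all: by end_near. Qed.

(** Starting from a point of [E], all later images lie in the cylinder of [w], which is closed. *)
Lemma coding_cylinder omega w : mkseq omega (size w) = w ->
  (word_map Phi w @` E) (coding Phi omega).
Proof.
move=> ew; have [[e Ee] _ E01 _] := attE.
apply: (@closed_cvg _ _ \oo _ (fun n => word_map Phi (mkseq omega n) e)
  (word_map Phi w @` E)); last exact: word_map_cvg (E01 _ Ee).
  by apply: compact_closed; [exact: norm_hausdorff|exact: cylinder_compact].
near=> n; have nm : (size w <= n)%N by near: n; exact: nbhs_infty_ge.
have [v ->] := mkseq_prefix omega nm; rewrite ew word_map_cat.
by exists (word_map Phi v e) => //; apply: (word_map_attractor attE); exists e.
Unshelve. all: by end_near. Qed.

Lemma coding_attractor omega : E (coding Phi omega).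
Proof. by have := coding_cylinder (omega := omega) (w := [::]) erefl; rewrite image_id. Qed.

Variable tau : 'S_d.
Hypothesis neat : neat_projection Phi tau.

(** The image lies in two boxes that a coordinate [i] separates, hence at an end of the interval of
    the prefix of [omega]. To keep containing that end, each later interval must touch the same end
    of its predecessor. *)
Lemma coding_overlap omega w : (word_map Phi w @` E) (coding Phi omega) ->
  mkseq omega (size w) <> w ->
  exists i, (exists a b, disj_itv (Phi a i) (Phi b i)) /\
   ((forall n, (size w <= n)%N -> (Phi (omega n) i).2 = 0) \/
    (forall n, (size w <= n)%N -> (Phi (omega n) i).1 + (Phi (omega n) i).2 = 1)).
Proof.
move=> ww /eqP nw; have [_ _ E01 _] := attE.
have [i [dab dj]] := separate_words ifsPhi neat (size_mkseq _ _) nw.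
exists i; split => //.
have /andP[wl wr] : (stopped Phi 0 i w).2 <= coding Phi omega ord0 i <=
    (stopped Phi 0 i w).1 + (stopped Phi 0 i w).2.
  by case: ww => e Ee <-; have := in_box_word ifsPhi w (lexx 0) (E01 _ Ee) i.
have /andP[vl vr] := coding_in_box omega (size w) i.
case: dj => dj; [right|left] => n nw'.
  have /andP[_ h1] := coding_in_box omega n.+1 i.
  have [v e] := mkseq_prefix omega nw'.
  have [_ ] := stopped_nest ifsPhi 0 i (mkseq omega (size w)) v; rewrite -e.
  have := shift_le1 ifsPhi (omega n) i.
  have := stopped_gt0 ifsPhi 0 i (mkseq omega n).
  move: h1; rewrite mkseqS stopped0_rcons //=.
  by move: (coding _ _) vr dj wl => c; nra.
have /andP[h1 _] := coding_in_box omega n.+1 i.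
have [v e] := mkseq_prefix omega nw'.
have [+ _] := stopped_nest ifsPhi 0 i (mkseq omega (size w)) v; rewrite -e.
have := shift_ge0 ifsPhi (omega n) i.
have := stopped_gt0 ifsPhi 0 i (mkseq omega n).
move: h1; rewrite mkseqS stopped0_rcons //=.
by move: (coding _ _) vl dj wr => c; nra.
Qed.

(** Two nonoverlapping intervals cannot both start at 0 or both end at 1. Together with
    [coding_overlap], this gives a letter missing from the tail of the code. *)
Lemma disj_itv_ends a b i : disj_itv (Phi a i) (Phi b i) ->
  (exists c, (Phi c i).2 != 0) /\ (exists c, (Phi c i).1 + (Phi c i).2 != 1).
Proof.
have := ratio_gt0 ifsPhi a i; have := ratio_gt0 ifsPhi b i.
have := shift_ge0 ifsPhi a i; have := shift_ge0 ifsPhi b i.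
have := shift_le1 ifsPhi a i; have := shift_le1 ifsPhi b i.
move=> h1 h2 h3 h4 h5 h6 [h|h]; split.
- by exists b; rewrite gt_eqF //; lra.
- by exists a; rewrite lt_eqF //; lra.
- by exists a; rewrite gt_eqF //; lra.
- by exists b; rewrite lt_eqF //; lra.
Qed.

(** The preimage of an open set is the union of the code cylinders whose geometric cylinders lie
    inside it, and there are only countably many words. *)
Lemma coding_measurable (a0 : D) :
  measurable_fun setT (coding Phi : code_measurable a0 -> borel 'rV[R]_d).
Proof.
apply: measurability; first exact: erefl.
move=> _ [U oU <-]; rewrite setTI.
have -> : coding Phi @^-1` U = \bigcup_(w : seq D)
    (if `[< word_map Phi w @` E `<=` U >] then code_cylinder w else set0).
  apply/seteqP; split => omega /=; last first.
    by move=> [w _]; case: asboolP => // wU /coding_cylinder; exact: wU.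
  move=> Uo; have /nbhs_ballP[e /= e0 eU] : nbhs (coding Phi omega) U.
    exact: open_nbhs_nbhs.
  have [r r01 hr] := ratio_bound ifsPhi.
  have [n hn] := stopped_small ifsPhi r01 (divr_gt0 e0 (ltr0n R 2)) (fun a i => (andP (hr a i)).2).
  exists (mkseq omega n) => //; case: asboolP => [_|[]].
    by rewrite /code_cylinder /= size_mkseq.
  move=> _ [x Ex <-]; apply: eU; split => // j i; rewrite ord1 /ball /=.
  have [_ _ E01 _] := attE.
  have := in_box_word ifsPhi (mkseq omega n) (lexx 0) (E01 _ Ex) i.
  have := coding_in_box omega n i.
  have := hn i (mkseq omega n); rewrite size_mkseq leqnn => /(_ isT).
  have e2 : 0 <= e / 2 by lra.
  rewrite leNgt stopped_active // -leNgt.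
  by rewrite ltr_norml; lra.
apply: countable_bigcupT_measurable => // w.
by case: ifP => _; [exact: code_cylinder_measurable|exact: measurable0].
Qed.

End Coding.

(** * Existence of the product measure *)

(** The law of a uniform point of [[0, 1[], whose digits in the expansion constructed below are
    independent letters of law [p]. *)
Definition unit_lebesgue (R : realType) :=
  mrestr (@lebesgue_measure R) (measurable_itv `[0%R, 1%R[).

Arguments unit_lebesgue : clear implicits.

HB.instance Definition _ (R : realType) := Measure.on (unit_lebesgue R).

Lemma unit_lebesgueT (R : realType) : unit_lebesgue R setT = 1%E.
Proof.
by rewrite /unit_lebesgue /mrestr setTI lebesgue_measure_itv /= lte_fin ltr01 oppr0 adde0.
Qed.

HB.instance Definition _ (R : realType) :=
  Measure_isProbability.Build _ _ _ (unit_lebesgue R) (unit_lebesgueT R).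

Section BernoulliCode.
Context {R : realType} {D : finType}.
Variables (p : D -> R) (a0 : D).
Hypothesis p_gt0 : forall a, 0 < p a.
Hypothesis p_sum : \sum_a p a = 1.

(** Partial sums in the order of enumeration: they cut [[0, 1[] into one half-open interval of
    length [p a] per letter. *)
Definition cumul (n : nat) : R := \sum_(a | (enum_rank a < n)%N) p a.

Let left_end (a : D) := cumul (enum_rank a).

Lemma cumulS a : cumul (enum_rank a).+1 = left_end a + p a.
Proof.
rewrite /left_end /cumul (bigD1 a) //= addrC; congr (_ + _).
apply: eq_bigl => b; rewrite ltnS ltn_neqAle andbC; congr (_ && _).
by rewrite (inj_eq val_inj) (inj_eq enum_rank_inj).
Qed.

Lemma cumul_le m n : (m <= n)%N -> cumul m <= cumul n.
Proof.
move=> mn; rewrite /cumul [leRHS](bigID (fun a => enum_rank a < m)%N) /=.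
rewrite (eq_bigl (fun a => (enum_rank a < n) && (enum_rank a < m))%N).
  by rewrite lerDl sumr_ge0 // => a _; exact: ltW.
move=> a; apply/idP/andP => [am|[]//]; split => //; exact: leq_trans mn.
Qed.

Lemma cumul0 : cumul 0 = 0.
Proof. by rewrite /cumul big_pred0. Qed.

Lemma cumul_card : cumul #|D| = 1.
Proof. by rewrite -p_sum; apply: eq_bigl => a; rewrite ltn_ord. Qed.

Let digit x := odflt a0 [pick a | left_end a <= x < left_end a + p a].

Lemma digit_mem x : 0 <= x < 1 -> left_end (digit x) <= x < left_end (digit x) + p (digit x).
Proof.
move=> /andP[x0 x1]; rewrite /digit; case: pickP => //= none; exfalso.
have xn n : (n <= #|D|)%N -> cumul n <= x.
  elim: n => [|n IH] nD; first by rewrite cumul0.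
  have := none (enum_val (Ordinal nD)).
  rewrite -cumulS /left_end enum_valK /= IH ?(ltnW nD) //= => /negbT.
  by rewrite -leNgt.
by have := xn _ (leqnn _); rewrite cumul_card leNgt x1.
Qed.

Lemma digit_uniq x a : left_end a <= x < left_end a + p a -> digit x = a.
Proof.
rewrite /digit => ax; case: pickP => [b bx|/(_ a)]; last by rewrite ax.
rewrite -cumulS in ax; rewrite -cumulS in bx.
move: ax bx => /andP[a1 a2] /andP[b1 b2] /=.
apply: enum_rank_inj; apply/val_inj/eqP => /=; rewrite eqn_leq; apply/andP; split.
  by rewrite leqNgt; apply/negP => /cumul_le h;
    have := lt_le_trans a2 (le_trans h b1); rewrite ltxx.
by rewrite leqNgt; apply/negP => /cumul_le h;
    have := lt_le_trans b2 (le_trans h a1); rewrite ltxx.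
Qed.

(** Stretches the interval of the first digit affinely onto [[0, 1[]; iterating it produces the
    further digits. *)
Let shift x := (x - left_end (digit x)) / p (digit x).

Lemma shift_itv x : 0 <= x < 1 -> 0 <= shift x < 1.
Proof.
move=> /digit_mem /andP[h1 h2]; rewrite /shift divr_ge0 ?subr_ge0 ?(ltW (p_gt0 _)) //=.
by rewrite ltr_pdivrMr // mul1r ltrBlDl.
Qed.

Let expansion x n := digit (iter n shift x).

Fixpoint word_left (w : seq D) : R :=
  if w is a :: w' then left_end a + p a * word_left w' else 0.

Lemma word_left_bounds (w : seq D) :
  0 <= word_left w /\ word_left w + \prod_(a <- w) p a <= 1.
Proof.
elim: w => [|b v [h1 h2]]; first by rewrite big_nil /= add0r.
have lb : 0 <= left_end b by rewrite -cumul0; exact: cumul_le.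
have lb1 : left_end b + p b <= 1 by rewrite -cumulS -cumul_card; exact: cumul_le.
have pb := p_gt0 b; rewrite big_cons /=; split; nra.
Qed.

(** By induction: rescaling by [shift] removes the first digit and turns the interval of [a :: w]
    into that of [w]. *)
Lemma expansion_word w x : 0 <= x < 1 -> (mkseq (expansion x) (size w) = w <->
  word_left w <= x < word_left w + \prod_(a <- w) p a).
Proof.
elim: w x => [|a w IH] x x01; first by rewrite big_nil /= add0r.
have -> : mkseq (expansion x) (size (a :: w)) =
    digit x :: mkseq (expansion (shift x)) (size w).
  rewrite /mkseq /= -[1%N]addn0 iotaDl -map_comp; congr cons.
  by apply: eq_map => n /=; rewrite /expansion add1n iterSr.
have [h1 h2] := word_left_bounds w; rewrite big_cons /=.
have digE : left_end a <= x < left_end a + p a ->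
    shift x = (x - left_end a) / p a by rewrite /shift => /digit_uniq ->.
have P0 : 0 < \prod_(b <- w) p b by exact: prodr_gt0.
have pa := p_gt0 a; split.
  move=> [ax] /IH; have := digit_mem x01; rewrite ax => dm.
  rewrite digE // => /(_ _)/andP[]; first by rewrite -digE //; exact: shift_itv.
  rewrite ler_pdivlMr // ltr_pdivrMr // => h3 h4; apply/andP; split; lra.
move=> xw; have ax : left_end a <= x < left_end a + p a by nra.
rewrite (digit_uniq ax); congr cons; apply/IH; first exact: shift_itv.
rewrite digE // ler_pdivlMr // ltr_pdivrMr //; nra.
Qed.

(* The value outside the unit interval is irrelevant for the measure and only
   serves to keep the map measurable. *)
Definition random_code (x : measurableTypeR R) : code_measurable a0 :=
  if x \in `[0, 1[ then expansion x else fun=> a0.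

(** Outside [[0, 1[] the code is constantly [a0], so the complement is added exactly for words made
    of [a0] alone. *)
Lemma random_code_preimage w : random_code @^-1` (code_cylinder w) =
  [set` `[word_left w, word_left w + \prod_(a <- w) p a[]
   `|` (if w == nseq (size w) a0 then ~` [set` `[0, 1[] else set0).
Proof.
have [h1 h2] := word_left_bounds w.
apply/seteqP; split => x; rewrite /preimage /random_code /code_cylinder /=.
  case: ifPn; rewrite in_itv /= => x01.
    by move/(expansion_word _ x01) => xw; left; rewrite in_itv.
  move=> ew; right; have -> : w == nseq (size w) a0.
    rewrite -{1}ew; apply/eqP; rewrite /mkseq.
    by elim: (size w) (0%N) => //= n IH m; rewrite IH.
  by rewrite /= in_itv /=; exact/negP.
case=> [|].
  rewrite in_itv /= => xw.
  have x01 : 0 <= x < 1 by lra.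
  by rewrite in_itv /= x01; apply/expansion_word.
case: eqP => // ew /=; rewrite in_itv /= => /negP/negbTE ->.
rewrite [RHS]ew /mkseq.
by elim: (size w) (0%N) => //= n IH m; rewrite IH.
Qed.

Lemma random_code_measurable : measurable_fun [set: measurableTypeR R] random_code.
Proof.
apply: measurability; first exact: erefl.
move=> _ [_ [w _ <-] <-]; rewrite setTI random_code_preimage.
apply: measurableU; first exact: measurable_itv.
by case: ifP => _ //; apply: measurableC; exact: measurable_itv.
Qed.

Lemma product_measure_exists :
  exists nu : probability (code_measurable a0) R, product_measure p nu.
Proof.
pose X : {mfun measurableTypeR R >-> code_measurable a0} :=
  HB.pack random_code (isMeasurableFun.Build _ _ _ _ _ random_code_measurable).
exists (distribution (unit_lebesgue R) X) => w.
have [h1 h2] := word_left_bounds w.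
have P0 : 0 < \prod_(a <- w) p a by exact: prodr_gt0.
rewrite /distribution /pushforward /= random_code_preimage.
(* The part outside [[0, 1[] does not count for the restricted measure. *)
rewrite /unit_lebesgue /mrestr setIUl (_ : (if _ then _ else _) `&` _ = set0) ?setU0.
  rewrite setIidl; last by move=> x /=; rewrite !in_itv /=; lra.
  by rewrite lebesgue_measure_itv /= lte_fin ltrDl P0 -EFinB addrC addKr.
by case: ifP => _; rewrite ?set0I // setICl.
Qed.

End BernoulliCode.

(** * The Bernoulli measure *)

Section BernoulliMass.
Context {R : realType} {d : nat} {D : finType}.
Variables (Phi : D -> {ffun 'I_d -> R * R}) (E : set 'rV[R]_d).
Variables (tau : 'S_d) (beta : 'I_d -> R).
Hypothesis d_gt0 : (0 < d)%N.
Hypothesis ifsPhi : diagonal_ifs Phi.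
Hypothesis attE : attractor Phi E.
Hypothesis order : coordinate_ordering Phi tau.
Hypothesis neat : neat_projection Phi tau.
Hypothesis betaP : beta_sequence Phi tau beta.

Let p := tau_weight Phi tau beta.

Lemma bernoulli_measure_exists :
  exists mu : probability (borel 'rV[R]_d) R, bernoulli_measure Phi p mu.
Proof.
have [a0] := attractor_letter attE.
have [nu nuP] := product_measure_exists a0
  (tau_weight_gt0 ifsPhi tau beta) (sum_tau_weight ifsPhi betaP a0).
have mX := @coding_measurable _ _ _ _ _ ifsPhi attE a0.
pose X : {mfun code_measurable a0 >-> borel 'rV[R]_d} :=
  HB.pack (coding Phi : code_measurable a0 -> borel 'rV[R]_d)
    (isMeasurableFun.Build _ _ _ _ _ mX).
by exists (distribution nu X), a0, nu.
Qed.

Variable mu : probability (borel 'rV[R]_d) R.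
Hypothesis muP : bernoulli_measure Phi p mu.

Lemma cylinder_closed w : closed (word_map Phi w @` E).
Proof.
by apply: compact_closed; [exact: norm_hausdorff|exact: (cylinder_compact attE)].
Qed.

Lemma closed_borel (A : set 'rV[R]_d) : closed A -> measurable (A : set (borel 'rV[R]_d)).
Proof.
move=> cA; rewrite -[A]setCK; apply: measurableC.
by apply: sub_sigma_algebra; exact: closed_openC.
Qed.

Lemma bernoulli_outside : mu (~` E) = 0%E.
Proof.
have mE : measurable (E : set (borel 'rV[R]_d)).
  apply: closed_borel; have := @cylinder_closed [::]; by rewrite image_id.
have [a0 [nu [_ ->]]] := muP; last exact: measurableC.
rewrite /pushforward (_ : _ @^-1` _ = set0) ?measure0 //.
by apply/seteqP; split => omega //= nE; apply: nE; exact: (coding_attractor ifsPhi attE).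
Qed.

(** The preimage of the cylinder contains all codes starting with [w]; any other code in it avoids
    some letter from position [size w] on, and the union of these events over the finitely many
    letters is null. *)
Lemma bernoulli_cylinder w : mu (word_map Phi w @` E) = (\prod_(a <- w) p a)%:E.
Proof.
have [a0 [nu [nuP muE]]] := muP.
have mA := closed_borel (@cylinder_closed w).
rewrite muE // /pushforward.
set A := _ @^-1` _.
have mA' : measurable (A : set (code_measurable a0)).
  by rewrite /A -[X in measurable X]setTI; exact: (@coding_measurable _ _ _ _ _ ifsPhi attE a0).
apply/eqP; rewrite eq_le; apply/andP; split; last first.
  rewrite -nuP; apply: le_measure; rewrite ?inE //; first exact: code_cylinder_measurable.
  by move=> omega; exact: (coding_cylinder ifsPhi attE).
pose B : set (code_measurable a0) :=
  \big[setU/set0]_(c <- enum D) avoid_letter (a0 := a0) c (size w).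
have mB : measurable B.
  by apply: bigsetU_measurable => c _; exact: avoid_letter_measurable.
apply: (@le_trans _ _ (nu ((code_cylinder w : set (code_measurable a0)) `|` B))).
  apply: le_measure; rewrite ?inE //.
    by apply: measurableU => //; exact: code_cylinder_measurable.
  move=> omega Aw; have [ew|nw] := pselect (mkseq omega (size w) = w); first by left.
  right; rewrite /B -bigcup_seq.
  have [i [[a [b dab]] ends]] := coding_overlap ifsPhi attE neat Aw nw.
  have [[c0 hc0] [c1 hc1]] := disj_itv_ends ifsPhi dab.
  (* If all later intervals start at 0, the letter [c0] cannot occur; if all end at 1, the letter
     [c1] cannot. *)
  case: ends => h; [exists c0|exists c1]; rewrite /= ?mem_enum // => m km.
    by apply: contraNneq hc0 => <-; rewrite h.
  by apply: contraNneq hc1 => <-; rewrite h.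
have le_sum : (nu ((code_cylinder w : set (code_measurable a0)) `|` B) <=
    nu (code_cylinder w) + nu B)%E.
  by apply: measureU2 => //; exact: code_cylinder_measurable.
apply: (le_trans le_sum).
have -> : nu B = 0%E.
  apply/eqP; rewrite eq_le measure_ge0 andbT.
  apply: le_trans (measure_bigsetU_le _ _ _) _.
    by move=> c; exact: avoid_letter_measurable.
  rewrite big1 // => c _; apply: (avoid_letter_null (p := p)) => //.
    exact: (tau_weight_gt0 ifsPhi).
  exact: (sum_tau_weight ifsPhi betaP a0).
by rewrite adde0 nuP.
Qed.

Lemma bernoulli_box_counting : cylinder_box_counting_measure Phi E mu.
Proof.
split; first exact: (cylinders_vitali ifsPhi attE neat).
split; first exact: bernoulli_outside.
exists (\sum_j beta j); split.
  exact: (attractor_box_dim d_gt0 ifsPhi attE order neat betaP).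
have [M M0 hM] := cylinder_packing d_gt0 ifsPhi attE order neat betaP.
exists M; split => // k _ _ [w _ <-].
(* At most 1/2 and at most half of every side, so each [delta] up to [delta0] is strictly below 1
   and below all sides of [w]. *)
pose delta0 : R := \big[Num.min/2^-1]_i ((stopped Phi 0 i w).1 / 2).
exists delta0; split.
  apply: lt_bigmin; first by rewrite invr_gt0.
  by move=> i _; rewrite divr_gt0 ?stopped_gt0.
move=> delta /andP[d0 dd].
have below : below_word Phi delta w.
  split.
    have : delta0 <= 2^-1 by exact: bigmin_le_id.
    by rewrite d0 /=; lra.
  move=> i; have : delta0 <= (stopped Phi 0 i w).1 / 2 by exact: bigmin_le.
  have := stopped_gt0 ifsPhi 0 i w; lra.
have := hM delta w below; rewrite box_weight0 // -/p.
rewrite !EFinM -bernoulli_cylinder => /andP[h1 h2]; split.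
  exact: h1.
exact: h2.
Qed.

End BernoulliMass.

Theorem theorem1p4 (R : realType) (d : nat) (D : finType)
    (Phi : D -> {ffun 'I_d -> R * R}) (E : set 'rV[R]_d)
    (tau : 'S_d) (beta : 'I_d -> R) :
  (0 < d)%N ->
  diagonal_ifs Phi ->
  attractor Phi E ->
  coordinate_ordering Phi tau ->
  neat_projection Phi tau ->
  beta_sequence Phi tau beta ->
  has_box_dim (@euclid R d) E (\sum_(j < d) beta j) /\
  (exists mu : probability (borel 'rV[R]_d) R,
     bernoulli_measure Phi (tau_weight Phi tau beta) mu) /\
  (forall mu : probability (borel 'rV[R]_d) R,
     bernoulli_measure Phi (tau_weight Phi tau beta) mu ->
     cylinder_box_counting_measure Phi E mu).
Proof.
move=> d0 ifsPhi attE order neat betaP; split.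
  exact: (attractor_box_dim d0 ifsPhi attE order neat betaP).
split; first exact: (bernoulli_measure_exists ifsPhi attE betaP).
by move=> mu; exact: (bernoulli_box_counting d0 ifsPhi attE order neat betaP).
Qed.
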